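(* Let $G=(V,E)$ be a connected, locally finite graph, let $\Gamma$ be a transitive nonunimodular subgroup of $\mathrm{Aut}(G)$, and let $w:\Omega\to[0,\infty)$ be a good weight function. Write $z_{c,\lambda}=z_{c,\lambda}(w)$, $\mu_{c,\lambda}=\mu_{c,\lambda}(w)$ and $z_t=z_t(w)$. Then the following hold. 1. For every $\lambda\neq1/2$, there exists a positive constant $C_\lambda$ such that $$\frac{z_{c,\lambda}}{z_{c,\lambda}-z}\leq\chi_w(z,\lambda)\leq\frac{C_\lambda z_{c,\lambda}}{z_{c,\lambda}-z}\quad\text{ and }\quad\mu_{c,\lambda}^n\leq Z_w(\lambda;n)\leq C_\lambda\mu_{c,\lambda}^n$$ for every $0<z<z_{c,\lambda}$ and every integer $n\geq0$. 2. For every $z\in[0,z_t)$, there exists a positive constant $c_z$ such that $$G_w(z;x)\leq e^{-c_z d(0,x)}$$ for every $x\in V$. 3. For every $\lambda\neq1/2$, there exist positive constants $c_\lambda,c_\lambda'$ such that $$\mathbb{P}_{w,\lambda,n}\Bigl[\operatorname{sgn}(\lambda-1/2)\log\Delta(0,X_n)\geq c_\lambda n\Bigr]\geq1-e^{-c_\lambda n}$$ for every integer $n\geq0$, and hence $$\mathbb{P}_{w,\lambda,n}\Bigl[d(0,X_n)\geq c_\lambda' n\Bigr]\geq1-e^{-c_\lambda' n}$$ for every integer $n\geq0$.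
   Context: Let $G=(V,E)$ be a connected, locally finite graph with automorphism group $\mathrm{Aut}(G)$ and graph distance $d$. A subgroup $\Gamma\subseteq \mathrm{Aut}(G)$ is transitive if for any $u,v\in V$ there is $\gamma\in\Gamma$ with $\gamma u=v$. The modular function $\Delta=\Delta_\Gamma:V^2\to(0,\infty)$ of a transitive subgroup $\Gamma$ is $\Delta(x,y)=|\mathrm{Stab}_y x|/|\mathrm{Stab}_x y|$, where $\mathrm{Stab}_x y$ is the orbit of $y$ under the stabilizer of $x$ in $\Gamma$. $\Gamma$ is unimodular if $\Delta\equiv 1$, and nonunimodular otherwise. Fix a root vertex $0\in V$. A path of length $n$ in $G$ is a sequence of vertices $\omega(0),\dots,\omega(n)$ together with, for each $0\le i<n$, an oriented edge from $\omega(i)$ to $\omega(i+1)$ (a multigraph homomorphism from the line graph with $n$ edges into $G$; vertices may be repeated). $\Omega$ is the set of all finite-length paths in $G$; $|\omega|$ is the length of $\omega$, $\omega^-,\omega^+$ are its first and last vertices, $\omega^\leftarrow$ its reversal. Paths $(\omega,\eta)$ are contiguous if $\omega^+=\eta^-$, in which case $\omega\circ\eta$ is their concatenation; a contiguous pair is disjoint if $\omega(i)\ne\eta(j)$ for every $i<|\omega|$ and $j>0$. A weight function $w:\Omega\to[0,\infty)$ is good if it is: $\Gamma$-invariant ($w(\gamma\omega)=w(\omega)$ for all $\gamma\in\Gamma$ and $\omega\in\Omega$); reversible ($w(\omega)=w(\omega^\leftarrow)$); non-degenerate ($w(\omega)=1$ if $|\omega|=0$ and $w(\omega)\ge1$ if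 $|\omega|=1$); zero-range ($w(\omega\circ\eta)=w(\omega)w(\eta)$ for all contiguous disjoint pairs); and repulsive ($w(\omega\circ\eta)\le w(\omega)w(\eta)$ for all contiguous pairs). For $\lambda\in\mathbb{R}$, $n\ge0$, let $Z_w(\lambda;n)=\sum_{\omega\in\Omega:\,\omega^-=0,\,|\omega|=n}w(\omega)\Delta^\lambda(0,\omega^+)$ and $\chi_w(z,\lambda)=\sum_{n\ge0}z^nZ_w(\lambda;n)$. $Z_w(\lambda;n)$ is submultiplicative in $n$, so $\mu_{c,\lambda}(w)=\lim_{n\to\infty}Z_w(\lambda;n)^{1/n}=\inf_{n\ge1}Z_w(\lambda;n)^{1/n}$ is well defined; set $z_{c,\lambda}(w)=\mu_{c,\lambda}(w)^{-1}$ and $z_t(w)=z_{c,1/2}(w)$. The two-point function is $G_w(z;x)=\sum_{\omega\in\Omega:\,\omega^-=0,\,\omega^+=x}w(\omega)z^{|\omega|}$ (with $z^0=1$). $\mathbb{P}_{w,\lambda,n}$ is the probability measure on paths $\omega$ of length $n$ with $\omega^-=0$ given by $\mathbb{P}_{w,\lambda,n}(\{\omega\})=Z_w(\lambda;n)^{-1}w(\omega)\Delta^\lambda(0,\omega^+)$, and $X=(X_i)_{i=0}^n$ denotes the random path sampled from it. $\operatorname{sgn}$ is the sign function.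
   Formalization: In item 2 the bound proved is G_w(z;x) ≤ C_z e^{-c_z d(0,x)} with a positive constant C_z depending on z; without C_z it fails at x = 0, e.g. for w ≡ 1 on a regular tree with the stabilizer of an end, where G_w(z;0) > 1 for 0 < z < z_t. *)

(* Defs.v *)
From HB Require Import structures.
From mathcomp Require Import all_boot all_order all_algebra finmap.
From mathcomp Require Import all_classical all_reals all_analysis.
Set Implicit Arguments.
Unset Strict Implicit.
Unset Printing Implicit Defensive.
Import Order.TTheory GRing.Theory Num.Theory.
Local Open Scope classical_set_scope.
Local Open Scope ring_scope.

(* Undirected multigraphs, given by their oriented edges ("darts") and the
   orientation-reversing involution.  Several darts may have the same source
   and target, and a loop may be either two mutually reverse darts or a single
   dart fixed by the involution. *)
Record mgraph := MGraph {
  vertex :> choiceType;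
  dart : choiceType;
  src : dart -> vertex;
  tgt : dart -> vertex;
  rev_dart : dart -> dart;
  rev_dartK : involutive rev_dart;
  src_rev : forall e, src (rev_dart e) = tgt e }.

Section Paths.
Variable G : mgraph.

Lemma tgt_rev (e : dart G) : tgt (rev_dart e) = src e.
Proof. by rewrite -src_rev rev_dartK. Qed.

Fixpoint is_walk (v : G) (s : seq (dart G)) : bool :=
  if s is e :: s' then (src e == v) && is_walk (tgt e) s' else true.

Definition walk_end (v : G) (s : seq (dart G)) : G := last v (map (@tgt G) s).

Definition gpath : Type := {p : G * seq (dart G) | is_walk p.1 p.2}.

Definition mkpath (v : G) (s : seq (dart G)) (h : is_walk v s) : gpath :=
  exist (fun p : G * seq (dart G) => is_walk p.1 p.2) (v, s) h.

Definition pstart (p : gpath) : G := (val p).1.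
Definition pdarts (p : gpath) : seq (dart G) := (val p).2.
Definition pend (p : gpath) : G := walk_end (pstart p) (pdarts p).
Definition plen (p : gpath) : nat := size (pdarts p).

(* Only meaningful for i <= plen p. *)
Definition pvertex (p : gpath) (i : nat) : G :=
  nth (pstart p) (pstart p :: map (@tgt G) (pdarts p)) i.

Lemma is_walk_cat v s t :
  is_walk v (s ++ t) = is_walk v s && is_walk (walk_end v s) t.
Proof. by elim: s v => [|e s IHs] v //=; rewrite IHs andbA. Qed.

Lemma walk_rev v s : is_walk v s ->
  is_walk (walk_end v s) (rev (map (@rev_dart G) s)) /\
  walk_end (walk_end v s) (rev (map (@rev_dart G) s)) = v.
Proof.
elim: s v => [|e s IHs] v //= /andP[/eqP <- /IHs [ws es]].
have -> : walk_end (src e) (e :: s) = walk_end (tgt e) s by [].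
rewrite rev_cons -cats1 is_walk_cat ws es /= src_rev eqxx; split=> //.
by rewrite /walk_end map_cat last_cat /= tgt_rev.
Qed.

Lemma pcat_proof (p q : gpath) : pend p = pstart q ->
  is_walk (pstart p) (pdarts p ++ pdarts q).
Proof.
move=> pq; rewrite is_walk_cat (valP p) /= -/(pend p) pq; exact: (valP q).
Qed.

Definition pcat (p q : gpath) (pq : pend p = pstart q) : gpath :=
  mkpath (pcat_proof pq).

Definition prev (p : gpath) : gpath := mkpath (walk_rev (valP p)).1.

Definition disjoint_paths (p q : gpath) : Prop :=
  forall i j, (i < plen p)%N -> (0 < j <= plen q)%N -> pvertex p i <> pvertex q j.

Definition connected_graph : Prop :=
  forall x y : G, exists p : gpath, pstart p = x /\ pend p = y.

Definition locally_finite : Prop :=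
  forall x : G, finite_set [set e : dart G | src e = x].

Definition has_path_of_length (x y : G) : pred nat :=
  fun n => `[< exists p : gpath, [/\ pstart p = x, pend p = y & plen p = n] >].

(* The junk value 0 is never reached in a connected graph. *)
Definition gdist (x y : G) : nat :=
  if pselect (exists n, has_path_of_length x y n) is left h then ex_minn h
  else 0%N.

Record gaut := GAut {
  av : G -> G;
  avV : G -> G;
  ad : dart G -> dart G;
  adV : dart G -> dart G;
  avK : cancel av avV;
  avVK : cancel avV av;
  adK : cancel ad adV;
  adVK : cancel adV ad;
  src_ad : forall e, src (ad e) = av (src e);
  tgt_ad : forall e, tgt (ad e) = av (tgt e);
  rev_ad : forall e, rev_dart (ad e) = ad (rev_dart e) }.

Definition aut_id : gaut :=
  @GAut id id id id (fun=> erefl) (fun=> erefl) (fun=> erefl) (fun=> erefl)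
    (fun=> erefl) (fun=> erefl) (fun=> erefl).

Definition aut_comp (f g : gaut) : gaut.
Proof.
refine (@GAut (av f \o av g) (avV g \o avV f) (ad f \o ad g) (adV g \o adV f)
  _ _ _ _ _ _ _) => x /=.
- by rewrite !avK.
- by rewrite !avVK.
- by rewrite !adK.
- by rewrite !adVK.
- by rewrite !src_ad.
- by rewrite !tgt_ad.
- by rewrite !rev_ad.
Defined.

Definition aut_inv (f : gaut) : gaut.
Proof.
refine (@GAut (avV f) (av f) (adV f) (ad f)
  (@avVK f) (@avK f) (@adVK f) (@adK f) _ _ _) => e.
- by apply: (can_inj (@avK f)); rewrite -src_ad adVK avVK.
- by apply: (can_inj (@avK f)); rewrite -tgt_ad adVK avVK.
- by apply: (can_inj (@adK f)); rewrite -rev_ad !adVK.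
Defined.

Record aut_subgroup (Gam : set gaut) : Prop := AutSubgroup {
  subgroup_id : Gam aut_id;
  subgroup_comp : forall f g, Gam f -> Gam g -> Gam (aut_comp f g);
  subgroup_inv : forall f, Gam f -> Gam (aut_inv f) }.

Definition transitive_aut (Gam : set gaut) : Prop :=
  forall u v : G, exists2 f, Gam f & av f u = v.

Lemma pmap_proof (f : gaut) (p : gpath) :
  is_walk (av f (pstart p)) (map (ad f) (pdarts p)).
Proof.
rewrite /pstart /pdarts; case: p => -[v s] /=.
by elim: s v => [|e s IHs] v //= /andP[/eqP <- /IHs]; rewrite src_ad tgt_ad eqxx.
Qed.

Definition pmap_aut (f : gaut) (p : gpath) : gpath := mkpath (pmap_proof f p).

Definition stab_orbit (Gam : set gaut) (x y : G) : set G :=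
  [set z | exists f, [/\ Gam f, av f x = x & av f y = z]].

End Paths.

Section Weights.
Variables (R : realType) (G : mgraph) (Gam : set (gaut G)).

(* Stabilizer orbits are finite in a connected locally finite graph, so
   [fset_set] computes their true cardinality. *)
Definition modular (x y : G) : R :=
  #|` fset_set (stab_orbit Gam y x)|%:R / #|` fset_set (stab_orbit Gam x y)|%:R.

Definition unimodular : Prop := forall x y : G, modular x y = 1.

Record good_weight (w : gpath G -> R) : Prop := GoodWeight {
  weight_ge0 : forall p, 0 <= w p;
  weight_invariant : forall f p, Gam f -> w (pmap_aut f p) = w p;
  weight_reversible : forall p, w (prev p) = w p;
  weight_length0 : forall p, plen p = 0%N -> w p = 1;
  weight_length1 : forall p, plen p = 1%N -> 1 <= w p;
  weight_zero_range : forall p q (pq : pend p = pstart q),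
    disjoint_paths p q -> w (pcat pq) = w p * w q;
  weight_repulsive : forall p q (pq : pend p = pstart q),
    w (pcat pq) <= w p * w q }.

Variables (o : G) (w : gpath G -> R).

Definition paths_from (n : nat) : set (gpath G) :=
  [set p | pstart p = o /\ plen p = n].

(* The index set is finite when G is locally finite; [\sum_(_ \in _)] is a
   finitely supported sum. *)
Definition Zw (lam : R) (n : nat) : R :=
  \sum_(p \in paths_from n) (w p * modular o (pend p) `^ lam).

Definition chi (z lam : R) : \bar R :=
  (\sum_(0 <= n <oo) (z ^+ n * Zw lam n)%:E)%E.

Definition mu_c (lam : R) : R := limn (fun n : nat => Zw lam n `^ n%:R^-1).

Definition z_c (lam : R) : R := (mu_c lam)^-1.

Definition z_t : R := z_c 2^-1.

Definition two_point (z : R) (x : G) : \bar R :=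
  \esum_(p in [set p | pstart p = o /\ pend p = x]) (w p * z ^+ plen p)%:E.

(* The P_{w,lam,n}-probability of the event A, a set of paths. *)
Definition path_prob (lam : R) (n : nat) (A : set (gpath G)) : R :=
  \sum_(p \in paths_from n `&` A)
    ((Zw lam n)^-1 * (w p * modular o (pend p) `^ lam)).

End Weights.

(* Main.v *)
Require Import Defs.
From mathcomp Require Import all_boot all_order all_algebra finmap.
From mathcomp Require Import all_classical all_reals all_analysis.
From mathcomp Require Import ring lra zify.
Set Implicit Arguments.
Unset Strict Implicit.
Unset Printing Implicit Defensive.
Import Order.TTheory GRing.Theory Num.Theory.
Local Open Scope classical_set_scope.
Local Open Scope ring_scope.
(* The name also denotes the predecessor in a cyclic sequence. *)
Local Notation prev := Defs.prev.

(** Write h(x, y) = ln Delta(x, y).  This is an additive cocycle, so the tilt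
Delta^l is multiplicative along concatenations, and mass transport combined
with reversal gives Z(l; n) = Z(1 - l; n).  The whole theorem rests on one
strict inequality, [mu_c_strict]: mu_(1/2) < mu_l for every l <> 1/2, that is,
z_(c,l) < z_t.

Strict inequality.  Fix a direction s = 1 or s = -1 and measure heights by
s * h.  A bridge is a path that stays strictly above its starting point and
never exceeds its final height.  A bridge factors uniquely into irreducible
bridges, consecutive factors are disjoint, and the zero-range property makes the
weight multiplicative, so the total weights B of the bridges and I of the
irreducible ones are related by B = 1 + I B.  Suppose mu_l <= mu_(1/2).  For
z < z_t, with l or 1 - l as tilt, whichever favours the direction s, B is
at most the finite susceptibility, whence I <= 1 ([irreducible_le1]); this
persists at z = z_t because the terms of I are polynomials in z
([psum_le1_left]).  Moving the tilt back to 1/2 makes every irreducible bridge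
lighter, so there I < 1 ([irreducible_lt1]) and B is finite.  Unfolding a walk
at its successive extrema, as Hammersley and Welsh do, writes it as a product of
bridges of decreasing spans ([half_space_le]), so chi(z_t, 1/2) is at most a
multiple of the exponential of twice the total weight of the bridges
([psum_all_le]).  Submultiplicativity, however, makes every term
z_t^n Z(1/2; n) at least 1: a contradiction.  Heights may take a dense set of
values; factoring at cut times avoids any discretization of them.

Susceptibility.  At z = z_(c,l) < z_t the susceptibility of tilt 1/2 is finite.
Its square bounds the bubble, the total weight of pairs of walks that together
form a loop, since the tilts of the two walks cancel ([loop_pairs_le]).  Cutting a
contiguous pair of walks at their first meeting point gives, for
a_n = z_(c,l)^n Z(l; n) and K the square of that susceptibility,
(sum_(n <= N) a_n)^2 <= K (2N + 1) sum_(n <= 2N) a_n ([square_le_bubble]).  If the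
averages of a_n exceeded 6 K anywhere, this would make them grow
exponentially, while a_n grows subexponentially; and averages bounded by a
constant bound a_n itself by submultiplicativity ([bounded_of_doubling]).

Decay and ballisticity.  For z < z_t, the weight of the paths from o to x,
multiplied by either of Delta(o, x)^(1/2) and Delta(x, o)^(1/2), is at most the
susceptibility of tilt 1/2, so the two-point function is bounded; decreasing z
then makes it decay exponentially.  Finally, on the event that
sgn(l - 1/2) h(o, X_n) < c n the weight of tilt l is at most exp(|l - 1/2| c n)
times that of tilt 1/2, so its probability is at most
exp(|l - 1/2| c n) Z(1/2; n) / Z(l; n), which is exponentially small by the
strict inequality.  The distance is handled by |h(o, x)| <= L d(o, x). *)

(** * Sums of nonnegative terms *)

Section NonnegativeSums.
Context {R : realType}.

Lemma le_esum_subset (T : choiceType) (P Q : set T) (f : T -> \bar R) :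
  P `<=` Q -> (forall t, Q t -> (0 <= f t)%E) ->
  (\esum_(t in P) f t <= \esum_(t in Q) f t)%E.
Proof.
move=> PQ f0; rewrite (esumID P Q) // (setIidr PQ) leeDl //.
by apply: esum_ge0 => t [/f0].
Qed.

Lemma le_esum_inj (T T' : choiceType) (P : set T) (Q : set T') (e : T -> T')
    (f : T -> \bar R) (g : T' -> \bar R) :
  (forall t, P t -> Q (e t)) -> set_inj P e ->
  (forall t, P t -> (f t <= g (e t))%E) -> (forall t, Q t -> (0 <= g t)%E) ->
  (\esum_(t in P) f t <= \esum_(t in Q) g t)%E.
Proof.
move=> PQ ei fg g0; apply: (@le_trans _ _ (\esum_(t in P) g (e t))%E).
  exact: le_esum.
rewrite -(esum_image P e g ei); apply: le_esum_subset => // _ [t Pt <-].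
exact: PQ.
Qed.

Lemma esumZl (T : choiceType) (P : set T) (c : R) (f : T -> \bar R) :
  0 <= c -> (forall t, P t -> (0 <= f t)%E) ->
  (\esum_(t in P) (c%:E * f t) = c%:E * \esum_(t in P) f t)%E.
Proof.
move=> c0 f0; have [->|cn0] := eqVneq c 0.
  by rewrite mul0e esum1 // => t _; rewrite mul0e.
have cp : 0 < c by rewrite lt_neqAle eq_sym cn0.
have half (d : R) (g : T -> \bar R) : 0 < d -> (forall t, P t -> (0 <= g t)%E) ->
    (\esum_(t in P) (d%:E * g t) <= d%:E * \esum_(t in P) g t)%E.
  move=> dp g0; apply: ge_ereal_sup => _ [F [finF FP] <-].
  have -> : (\sum_(t \in F) d%:E * g t = d%:E * \sum_(t \in F) g t)%E.
    rewrite !fsbig_finite //= big_seq [in RHS]big_seq ge0_sume_distrr // => t.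
    by rewrite in_fset_set // inE => /FP /g0.
  by rewrite lee_pmul2l // ereal_sup_ubound //; exists F.
apply/eqP; rewrite eq_le half //=.
rewrite -(@lee_pmul2l _ c^-1%:E) ?lte_fin ?invr_gt0 // muleA -EFinM mulVf // mul1e.
have ci : 0 < c^-1 by rewrite invr_gt0.
apply: (le_trans _ (half c^-1 (fun t => c%:E * f t)%E ci _)) => [|t Pt].
  by apply: le_esum => t Pt; rewrite muleA -EFinM mulVf // mul1e.
by rewrite mule_ge0 ?lee_fin ?f0.
Qed.

Lemma esum_le_bound (T : choiceType) (P : set T) (f : T -> \bar R) (M : \bar R) :
  (forall F, finite_set F -> F `<=` P -> (\esum_(t in F) f t <= M)%E) ->
  (forall t, P t -> (0 <= f t)%E) ->
  (\esum_(t in P) f t <= M)%E.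
Proof.
move=> h f0; apply: ge_ereal_sup => _ [F [finF FP] <-].
rewrite -esum_fset //; first exact: h.
by move=> t; rewrite inE => /FP /f0.
Qed.

End NonnegativeSums.

(** * Cutting and joining paths *)

Section PathSurgery.
Variable G : mgraph.
Implicit Types p q : gpath G.

Lemma gpath_eq p q : pstart p = pstart q -> pdarts p = pdarts q -> p = q.
Proof.
by case: p q => [[v s] h] [[v' s'] h'] /= *; apply: val_inj; congr pair.
Qed.

Lemma pvertex_end_take p i : (i <= plen p)%N ->
  pvertex p i = walk_end (pstart p) (take i (pdarts p)).
Proof.
case: p => -[v s] h; rewrite /pvertex /plen /walk_end /pstart /pdarts /=.
case: i => [|i] il; first by rewrite take0.
rewrite /= (last_nth v) size_map size_takel // /=.
by rewrite map_take nth_take.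
Qed.

Lemma pvertex0 p : pvertex p 0 = pstart p. Proof. by []. Qed.

Lemma pvertex_plen p : pvertex p (plen p) = pend p.
Proof. by rewrite pvertex_end_take // take_size. Qed.

Lemma ptake_proof k p : is_walk (pstart p) (take k (pdarts p)).
Proof.
by have := valP p; rewrite -/(pstart p) -/(pdarts p) -{1}(cat_take_drop k (pdarts p))
  is_walk_cat => /andP[].
Qed.

Lemma pdrop_proof k p :
  is_walk (walk_end (pstart p) (take k (pdarts p))) (drop k (pdarts p)).
Proof.
by have := valP p; rewrite -/(pstart p) -/(pdarts p) -{1}(cat_take_drop k (pdarts p))
  is_walk_cat => /andP[].
Qed.

Definition ptake k p : gpath G := mkpath (ptake_proof k p).
Definition pdrop k p : gpath G := mkpath (pdrop_proof k p).

Lemma pstart_take k p : pstart (ptake k p) = pstart p. Proof. by []. Qed.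

Lemma plen_take k p : (k <= plen p)%N -> plen (ptake k p) = k.
Proof. by move=> kp; rewrite /plen /pdarts /= size_takel. Qed.

Lemma plen_drop k p : plen (pdrop k p) = (plen p - k)%N.
Proof. by rewrite /plen /pdarts /= size_drop. Qed.

Lemma pend_take k p : (k <= plen p)%N -> pend (ptake k p) = pvertex p k.
Proof. by move=> kp; rewrite pvertex_end_take. Qed.

Lemma pstart_drop k p : (k <= plen p)%N -> pstart (pdrop k p) = pvertex p k.
Proof. by move=> kp; rewrite pvertex_end_take. Qed.

Lemma take_drop_contiguous k p : pend (ptake k p) = pstart (pdrop k p).
Proof. by []. Qed.

Lemma pend_drop k p : pend (pdrop k p) = pend p.
Proof.
rewrite /pend /walk_end /pstart /pdarts /= -last_cat -map_cat.
by rewrite cat_take_drop.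
Qed.

Lemma pvertex_take k p i : (i <= k <= plen p)%N ->
  pvertex (ptake k p) i = pvertex p i.
Proof.
move=> /andP[ik kp]; rewrite !pvertex_end_take ?plen_take //; last exact: leq_trans kp.
by rewrite /= /pdarts /= take_takel.
Qed.

Lemma pvertex_drop k p i : (k + i <= plen p)%N ->
  pvertex (pdrop k p) i = pvertex p (k + i).
Proof.
move=> kip; rewrite !pvertex_end_take ?plen_drop //; last by lia.
by rewrite /walk_end /pstart /pdarts /= -last_cat -map_cat takeD.
Qed.

(** Total, so that it can serve as a map between index sets of sums; on a
pair that is not contiguous the value [p] is arbitrary. *)
Definition pjoin p q : gpath G :=
  match pend p =P pstart q with
  | ReflectT e => pcat e
  | ReflectF _ => p
  end.

Lemma pjoinE p q (e : pend p = pstart q) : pjoin p q = pcat e.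
Proof.
by rewrite /pjoin; case: eqP => // e'; congr pcat; apply: eq_irrelevance.
Qed.

Lemma pjoin_take_drop k p : pjoin (ptake k p) (pdrop k p) = p.
Proof.
rewrite (pjoinE (take_drop_contiguous k p)).
by apply: gpath_eq => //; rewrite /pdarts /= cat_take_drop.
Qed.

Lemma pstart_join p q : pstart (pjoin p q) = pstart p.
Proof. by rewrite /pjoin; case: eqP. Qed.

Lemma pdarts_join p q : pend p = pstart q ->
  pdarts (pjoin p q) = pdarts p ++ pdarts q.
Proof. by move=> e; rewrite (pjoinE e). Qed.

Lemma plen_join p q : pend p = pstart q ->
  plen (pjoin p q) = (plen p + plen q)%N.
Proof. by move=> e; rewrite /plen pdarts_join // size_cat. Qed.

Lemma pend_join p q : pend p = pstart q -> pend (pjoin p q) = pend q.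
Proof.
move=> e; rewrite /pend /walk_end pstart_join pdarts_join //.
rewrite map_cat last_cat.
by have -> : last (pstart p) [seq tgt d | d <- pdarts p] = pstart q by exact: e.
Qed.

Lemma ptake_join p q : pend p = pstart q -> ptake (plen p) (pjoin p q) = p.
Proof.
move=> e; apply: gpath_eq; first by rewrite pstart_take pstart_join.
by rewrite {1}/pdarts /= pdarts_join // take_size_cat.
Qed.

Lemma pdrop_join p q : pend p = pstart q -> pdrop (plen p) (pjoin p q) = q.
Proof.
move=> e; apply: gpath_eq; last by rewrite {1}/pdarts /= pdarts_join // drop_size_cat.
rewrite pstart_drop ?plen_join ?leq_addr // -pend_take ?plen_join ?leq_addr //.
by rewrite ptake_join.
Qed.

Lemma pvertex_joinl p q i : pend p = pstart q -> (i <= plen p)%N ->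
  pvertex (pjoin p q) i = pvertex p i.
Proof.
move=> e ip; rewrite -{2}(ptake_join e) pvertex_take // ip plen_join //.
exact: leq_addr.
Qed.

Lemma pvertex_joinr p q i : pend p = pstart q -> (i <= plen q)%N ->
  pvertex (pjoin p q) (plen p + i) = pvertex q i.
Proof.
by move=> e iq; rewrite -{2}(pdrop_join e) pvertex_drop // plen_join // leq_add2l.
Qed.

Lemma pmap_start (f : gaut G) p : pstart (pmap_aut f p) = av f (pstart p).
Proof. by []. Qed.

Lemma pmap_len (f : gaut G) p : plen (pmap_aut f p) = plen p.
Proof. by rewrite /plen /pdarts /= size_map. Qed.

Lemma pmap_vertex (f : gaut G) p i : pvertex (pmap_aut f p) i = av f (pvertex p i).
Proof.
rewrite /pvertex /pstart /pdarts /= -map_comp.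
rewrite (eq_map (g := av f \o @tgt G)); last by move=> e /=; rewrite tgt_ad.
rewrite map_comp -[av f (val p).1 :: _]/(map (av f) (_ :: _)).
case: (ltnP i (size ((val p).1 :: [seq tgt i | i <- (val p).2]))) => il.
  by rewrite (nth_map (val p).1).
by rewrite !nth_default // size_map.
Qed.

Lemma pmap_end (f : gaut G) p : pend (pmap_aut f p) = av f (pend p).
Proof. by rewrite -!pvertex_plen pmap_len pmap_vertex. Qed.

Lemma pmap_inj (f : gaut G) : injective (pmap_aut f).
Proof.
move=> p q e; apply: gpath_eq.
  by have := congr1 (@pstart G) e; rewrite !pmap_start => /(can_inj (@avK _ f)).
by have := congr1 (@pdarts G) e => /(inj_map (can_inj (@adK _ f))).
Qed.

Lemma pmap_invK (f : gaut G) p : pmap_aut f (pmap_aut (aut_inv f) p) = p.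
Proof.
apply: gpath_eq; first by rewrite /pstart /= avVK.
by rewrite /pdarts /= mapK //; apply: adVK.
Qed.

Lemma pstart_prev p : pstart (prev p) = pend p. Proof. by []. Qed.

Lemma pend_prev p : pend (prev p) = pstart p.
Proof. exact: (walk_rev (valP p)).2. Qed.

Lemma plen_prev p : plen (prev p) = plen p.
Proof. by rewrite /plen /pdarts /= size_rev size_map. Qed.

Lemma prevK : involutive (@Defs.prev G).
Proof.
move=> p; apply: gpath_eq; first by rewrite pstart_prev pend_prev.
rewrite /pdarts /= map_rev revK -map_comp map_id_in // => e _ /=.
by rewrite rev_dartK.
Qed.

Lemma ptake_prev p i : (i <= plen p)%N ->
  ptake i (prev p) = prev (pdrop (plen p - i) p).
Proof.
move=> ip; apply: gpath_eq; first by rewrite pstart_take !pstart_prev pend_drop.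
rewrite /pdarts /= take_rev size_map map_drop; congr rev; congr drop.
Qed.

Lemma pvertex_prev p i : (i <= plen p)%N ->
  pvertex (prev p) i = pvertex p (plen p - i).
Proof.
move=> ip; rewrite -pend_take ?plen_prev // ptake_prev // pend_prev.
by rewrite pstart_drop // leq_subr.
Qed.

Definition pnil (v : G) : gpath G := @mkpath G v [::] isT.

Lemma pedge_proof (e : dart G) : is_walk (src e) [:: e].
Proof. by rewrite /= eqxx. Qed.

Definition pedge (e : dart G) : gpath G := mkpath (pedge_proof e).

Lemma plen0_nil p : plen p = 0%N -> p = pnil (pstart p).
Proof. by move=> /size0nil e; apply: gpath_eq. Qed.

Hypothesis Glf : locally_finite G.

Lemma finite_paths_len v n : finite_set [set p : gpath G | pstart p = v /\ plen p = n].
Proof.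
elim: n v => [|n IHn] v.
  apply: (@sub_finite_set _ _ [set pnil v]); last exact: finite_set1.
  by move=> p [<- /plen0_nil].
pose D := [set e : dart G | src e = v].
pose T := \bigcup_(e in D) [set pjoin (pedge e) q | q in
  [set p : gpath G | pstart p = tgt e /\ plen p = n]].
apply: (@sub_finite_set _ _ T); last first.
  by apply: bigcup_finite => [|e _]; [exact: Glf | exact: finite_image].
move=> p [sp lp].
have [e E] : exists e, pdarts (ptake 1 p) = [:: e].
  have: size (pdarts (ptake 1 p)) = 1%N by rewrite -/(plen _) plen_take ?lp.
  by case: (pdarts _) => [|e [|d s]] // _; exists e.
have := valP (ptake 1 p); rewrite -/(pdarts _) E => /andP[/eqP se _].
have e1 : ptake 1 p = pedge e by apply: gpath_eq; rewrite ?E.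
exists e; first by rewrite /D /= se.
exists (pdrop 1 p); last by rewrite -e1 pjoin_take_drop.
split; first by rewrite -take_drop_contiguous e1.
by rewrite plen_drop lp subn1.
Qed.

Lemma finite_paths_le v n : finite_set [set p : gpath G | pstart p = v /\ (plen p <= n)%N].
Proof.
apply: (@sub_finite_set _ _ (\bigcup_(m in `I_n.+1)
   [set p : gpath G | pstart p = v /\ plen p = m])).
  by move=> p [sp lp]; exists (plen p).
by apply: bigcup_finite => [|m _]; [exact: finite_II | exact: finite_paths_len].
Qed.

End PathSurgery.

(** * The modular function and mass transport *)

(** The standing assumptions, as a class so that lemmas about the action find
them by inference. *)
Class transitive_action (G : mgraph) (Gam : set (gaut G)) : Prop :=
  TransitiveAction {
    action_connected : connected_graph G;
    action_locally_finite : locally_finite G;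
    action_subgroup : aut_subgroup Gam;
    action_transitive : transitive_aut Gam }.

Existing Class good_weight.

Section ModularFunction.
Context {R : realType}.

Definition rcard (T : choiceType) (A : set T) : R := #|` fset_set A|%:R.

Lemma esum_const (T : choiceType) (A : set T) (c : \bar R) :
  finite_set A -> (0 <= c)%E -> (\esum_(t in A) c = (rcard A)%:E * c)%E.
Proof.
move=> finA c0; rewrite esum_fset // fsbig_finite //= big_const_seq count_predT.
rewrite /rcard; elim: #|` _| => [|n IHn]; first by rewrite mul0e.
by rewrite iterS IHn -natr1 EFinD ge0_muleDl ?lee_fin // mul1e addeC.
Qed.

Lemma rcard_bij (T T' : choiceType) (A : set T) (B : set T') (e : T -> T') :
  finite_set A -> set_bij A B e -> rcard A = rcard B.
Proof.
move=> finA AB; have finB : finite_set B.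
  by have [_ _ AB'] := AB; apply: sub_finite_set AB' _; apply: finite_image.
have := @reindex_esum R _ _ _ _ _ (fun=> 1%E) AB.
by rewrite !esum_const // !mule1 => -[].
Qed.

Context (G : mgraph) (Gam : set (gaut G)) {act : transitive_action Gam}.

Let Gconn : connected_graph G := action_connected.
Let Glf : locally_finite G := action_locally_finite.
Let Gsub : aut_subgroup Gam := action_subgroup.
Let Gtr : transitive_aut Gam := action_transitive.

Local Notation Stab := (stab_orbit Gam).
Local Notation Delta := (modular R Gam).

Lemma finite_stab_orbit x y : finite_set (Stab x y).
Proof.
have [p [sp ep]] := Gconn x y.
apply: (@sub_finite_set _ _ (@pend G @` [set q | pstart q = x /\ plen q = plen p])).
  move=> z [f [_ fx fy]]; exists (pmap_aut f p); last by rewrite pmap_end ep.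
  by rewrite /= pmap_start sp fx pmap_len.
by apply: finite_image; apply: finite_paths_len.
Qed.

Lemma stab_orbit_refl x y : Stab x y y.
Proof. by exists (aut_id G); split=> //; apply: subgroup_id. Qed.

Lemma rcard_stab_gt0 x y : 0 < rcard (Stab x y).
Proof.
rewrite ltr0n cardfs_gt0; apply/fset0Pn; exists y.
rewrite in_fset_set; last exact: finite_stab_orbit.
by rewrite inE; apply: stab_orbit_refl.
Qed.

Lemma modularE x y : Delta x y = rcard (Stab y x) / rcard (Stab x y).
Proof. by []. Qed.

Lemma modular_gt0 x y : 0 < Delta x y.
Proof. by rewrite modularE divr_gt0 ?rcard_stab_gt0. Qed.

Definition stab2_orbit x y z : set G :=
  [set v | exists f, [/\ Gam f, av f x = x, av f y = y & av f z = v]].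

Definition pair_orbit x y z : set (G * G) :=
  [set k | exists f, [/\ Gam f, av f x = x, av f y = k.1 & av f z = k.2]].

Lemma finite_stab2_orbit x y z : finite_set (stab2_orbit x y z).
Proof.
apply: sub_finite_set (finite_stab_orbit x z) => v [f [? ? _ ?]].
by exists f.
Qed.

Lemma aut_subgroup_compV f g : Gam f -> Gam g -> Gam (aut_comp (aut_inv f) g).
Proof. by move=> Gf Gg; apply: subgroup_comp => //; apply: subgroup_inv. Qed.

(** Count the orbit of the pair (y, z) under the stabilizer of [x] by fibres
over the first coordinate: each fibre is a translate of the orbit of [z] under
the common stabilizer of [x] and [y]. *)
Lemma card_pair_orbit x y z : (\esum_(k in pair_orbit x y z) 1 =
  (rcard (Stab x y) * rcard (stab2_orbit x y z))%:E :> \bar R)%E.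
Proof.
pose N u := [set v | pair_orbit x y z (u, v)].
have -> : pair_orbit x y z = Stab x y `*`` N.
  apply/seteqP; split=> [[u v] [f [Gf fx fy fz]]|[u v] [_]//].
  by split; exists f.
rewrite -(@esum_esum _ _ _ _ _ (fun _ _ => 1%E)) //.
rewrite (eq_esum (b := fun=> (rcard (stab2_orbit x y z))%:E)).
  rewrite esum_const ?lee_fin ?ler0n //; exact: finite_stab_orbit.
move=> u [f [Gf fx fy]].
rewrite (reindex_esum (stab2_orbit x y z) _ (av f)).
  by rewrite esum_const ?mule1 //; exact: finite_stab2_orbit.
split=> [v [g [Gg gx gy <-]]|a b _ _ /(can_inj (@avK _ f))//|v [g [Gg gx /= gy gz]]].
  by exists (aut_comp f g); split=> //=; [exact: subgroup_comp|rewrite gx|rewrite gy].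
exists (avV f v); last by rewrite avVK.
exists (aut_comp (aut_inv f) g); split => /=; first exact: aut_subgroup_compV.
- by rewrite gx -{1}fx avK.
- by rewrite gy -fy avK.
- by rewrite gz.
Qed.

Lemma pair_orbit_swap x y z : rcard (Stab x y) * rcard (stab2_orbit x y z) =
  rcard (Stab x z) * rcard (stab2_orbit x z y).
Proof.
have h y' z' : (\esum_(k in pair_orbit x y' z') 1 <=
    \esum_(k in pair_orbit x z' y') 1 :> \bar R)%E.
  apply: (le_esum_inj (e := fun k => (k.2, k.1))) => //.
    by move=> [u v] [f [? ? ? ?]]; exists f.
  by move=> [? ?] [? ?] _ _ /= [-> ->].
by have := conj (h y z) (h z y); rewrite !card_pair_orbit !lee_fin => -[? ?];
  apply/eqP; rewrite eq_le; apply/andP.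
Qed.

Lemma stab2_orbitC x y z : stab2_orbit x y z = stab2_orbit y x z.
Proof. by apply/seteqP; split=> v [f [? ? ? ?]]; exists f. Qed.

Lemma rcard_stab2_gt0 x y z : 0 < rcard (stab2_orbit x y z).
Proof.
rewrite ltr0n cardfs_gt0; apply/fset0Pn; exists z.
rewrite in_fset_set; last exact: finite_stab2_orbit.
by rewrite inE; exists (aut_id G); split=> //; apply: subgroup_id.
Qed.

(** With N_x the size of the orbit of the pair formed by the two other vertices
under the stabilizer of [x], [pair_orbit_swap] turns Delta(x, y) into N_y / N_x,
and such ratios telescope. *)
Lemma modular_cocycle x y z : Delta x y * Delta y z = Delta x z.
Proof.
rewrite !modularE.
have ex := pair_orbit_swap x y z.
have ey := pair_orbit_swap y x z.
have ez := pair_orbit_swap z x y.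
move: ex ey ez; rewrite (stab2_orbitC y x z) (stab2_orbitC z x y) (stab2_orbitC z y x).
have := rcard_stab2_gt0 x y z; have := rcard_stab2_gt0 x z y.
have := rcard_stab2_gt0 y z x.
have := rcard_stab_gt0 x y; have := rcard_stab_gt0 y x.
have := rcard_stab_gt0 x z; have := rcard_stab_gt0 z x.
have := rcard_stab_gt0 y z; have := rcard_stab_gt0 z y.
move: (rcard (Stab x y)) (rcard (Stab y x)) (rcard (Stab x z)) (rcard (Stab z x))
  (rcard (Stab y z)) (rcard (Stab z y)) (rcard (stab2_orbit x y z))
  (rcard (stab2_orbit x z y)) (rcard (stab2_orbit y z x)).
move=> a b c d e f tz ty tx f0 e0 d0 c0 b0 a0 tx0 ty0 tz0 ex ey ez.
have -> : a = c * ty / tz by apply: (canRL (mulfK _)) => //; apply: lt0r_neq0.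
have -> : b = e * tx / tz by apply: (canRL (mulfK _)) => //; apply: lt0r_neq0.
have -> : f = d * ty / tx by apply: (canRL (mulfK _)) => //; apply: lt0r_neq0.
by field; rewrite !lt0r_neq0.
Qed.

Lemma modular_refl x : Delta x x = 1.
Proof. by rewrite modularE divff // lt0r_neq0 // rcard_stab_gt0. Qed.

Lemma stab_orbit_bij f x y : Gam f ->
  set_bij (Stab x y) (Stab (av f x) (av f y)) (av f).
Proof.
move=> Gf; split=> [v [g [Gg gx <-]]|a b _ _ /(can_inj (@avK _ f))//|v [g [Gg gx gy]]].
  exists (aut_comp f (aut_comp g (aut_inv f))); split=> /=.
  - by do !apply: subgroup_comp => //; apply: subgroup_inv.
  - by rewrite avK gx.
  - by rewrite avK.
exists (avV f v); last by rewrite avVK.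
exists (aut_comp (aut_inv f) (aut_comp g f)); split=> /=.
- by apply: aut_subgroup_compV => //; apply: subgroup_comp.
- by rewrite gx avK.
- by rewrite gy.
Qed.

Lemma rcard_stab_invariant f x y : Gam f ->
  rcard (Stab (av f x) (av f y)) = rcard (Stab x y).
Proof.
move=> Gf; apply/esym; apply: rcard_bij (stab_orbit_bij x y Gf).
exact: finite_stab_orbit.
Qed.

Lemma modular_invariant f x y : Gam f -> Delta (av f x) (av f y) = Delta x y.
Proof. by move=> Gf; rewrite !modularE !rcard_stab_invariant. Qed.

(** Call [x] and [y] related when some group element takes [x] to [o] and [o]
to [y]; this is symmetric, and [x] has |Stab_x o| related vertices.  For related
[x] and [y], F x o = F o y and |Stab_o x| = |Stab_y o|, so summing
F o y / |Stab_y o| over the related pairs in the two possible orders gives the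
two sides. *)
Lemma mass_transport (o : G) (F : G -> G -> \bar R) :
  (forall x y, (0 <= F x y)%E) ->
  (forall f x y, Gam f -> F (av f x) (av f y) = F x y) ->
  (\esum_(x in [set: G]) F o x = \esum_(x in [set: G]) (F x o * (Delta o x)%:E))%E.
Proof.
move=> F0 Finv; pose Q x y := exists f, [/\ Gam f, av f x = o & av f o = y].
have QC x y : Q x y -> Q y x.
  move=> [f [Gf fx fo]]; exists (aut_inv f); split=> /=; first exact: subgroup_inv.
    by rewrite -fo avK.
  by rewrite -fx avK.
have Qbij x : exists f, set_bij (Stab x o) [set y | Q x y] (av f).
  have [f Gf fx] := Gtr x o; exists f.
  split=> [v [g [Gg gx <-]]|a b _ _ /(can_inj (@avK _ f))//|v [g [Gg gx gy]]].
    by exists (aut_comp f g); split=> //=; [exact: subgroup_comp|rewrite gx].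
  exists (avV f v); last by rewrite avVK.
  exists (aut_comp (aut_inv f) g); split=> /=; first exact: aut_subgroup_compV.
    by rewrite gx -fx avK.
  by rewrite gy.
have Qfin x : finite_set [set y | Q x y].
  have [f [_ _ fs]] := Qbij x.
  by apply: sub_finite_set fs _; apply: finite_image; apply: finite_stab_orbit.
have Qcard x : rcard [set y | Q x y] = rcard (Stab x o).
  have [f fb] := Qbij x; apply/esym; apply: rcard_bij fb.
  exact: finite_stab_orbit.
have cp x y := rcard_stab_gt0 x y.
pose K (x y : G) := (F o y * (rcard (Stab y o))^-1%:E)%E.
have K0 x y : (0 <= K x y)%E by rewrite mule_ge0 // lee_fin invr_ge0 ltW.
transitivity (\esum_(y in [set: G]) \esum_(x in [set x | Q y x]) K x y)%E.
  apply: eq_esum => y _; rewrite (esum_const (Qfin y) (K0 y y)).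
  by rewrite Qcard /K muleCA -EFinM divff ?mule1 // lt0r_neq0.
transitivity (\esum_(x in [set: G]) \esum_(y in [set y | Q x y]) K x y)%E.
  rewrite !esum_esum //.
  rewrite (reindex_esum ([set: G] `*`` (fun x => [set y | Q x y])) _
    (fun k : G * G => (k.2, k.1))) //.
  split=> [[x y] [_ /= /QC//]|[? ?] [? ?] _ _ /= [-> ->]//|[x y] [_ /= /QC xy]].
  by exists (y, x).
apply: eq_esum => x _.
rewrite (eq_esum (b := fun=> (F x o * (rcard (Stab o x))^-1%:E)%E)).
  rewrite esum_const //; last by rewrite mule_ge0 // lee_fin invr_ge0 ltW.
  by rewrite Qcard modularE muleCA EFinM.
by move=> y [f [Gf fx fo]]; rewrite /K -(rcard_stab_invariant o x Gf) -(Finv f x o Gf) fx fo.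
Qed.

End ModularFunction.

(** * Tilted weights and sums over paths *)

Section WeightedPathSums.
Context {R : realType} (G : mgraph) (Gam : set (gaut G)) {act : transitive_action Gam}.
Context (w : gpath G -> R) {wgood : good_weight Gam w}.

Let Glf : locally_finite G := action_locally_finite.
Let Gsub : aut_subgroup Gam := action_subgroup.
Let Gtr : transitive_aut Gam := action_transitive.

Local Notation Delta := (modular R Gam).
Implicit Types (p q r : gpath G) (A T : set (gpath G)).

Definition height (x y : G) : R := ln (Delta x y).

Lemma height_cocycle x y t : height x y + height y t = height x t.
Proof. by rewrite /height -lnM ?posrE ?modular_gt0 // modular_cocycle. Qed.

Lemma height_refl x : height x x = 0.
Proof. by rewrite /height modular_refl // ln1. Qed.

Lemma heightC x y : height y x = - height x y.
Proof. by have := height_cocycle x y x; rewrite height_refl; lra. Qed.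

Lemma height_invariant f x y : Gam f -> height (av f x) (av f y) = height x y.
Proof. by move=> Gf; rewrite /height modular_invariant. Qed.

Lemma modular_powR x y l : Delta x y `^ l = expR (l * height x y).
Proof. by rewrite /powR gt_eqF ?modular_gt0. Qed.

Lemma modular_expR x y : Delta x y = expR (height x y).
Proof. by rewrite lnK // posrE modular_gt0. Qed.

Definition pweight z l p : R :=
  w p * z ^+ plen p * expR (l * height (pstart p) (pend p)).

Lemma pweight_ge0 z l p : 0 <= z -> 0 <= pweight z l p.
Proof.
move=> z0; rewrite /pweight !mulr_ge0 ?expR_ge0 ?exprn_ge0 //.
exact: (weight_ge0 wgood).
Qed.

Lemma pweight_invariant z l f p : Gam f -> pweight z l (pmap_aut f p) = pweight z l p.
Proof.
move=> Gf; rewrite /pweight (weight_invariant wgood _ Gf) pmap_len pmap_end.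
by rewrite pmap_start (height_invariant _ _ Gf).
Qed.

Lemma pweight_nil z l p : plen p = 0%N -> pweight z l p = 1.
Proof.
move=> p0; rewrite /pweight (weight_length0 wgood) // p0 expr0 !mul1r.
by rewrite -pvertex_plen p0 pvertex0 height_refl mulr0 expR0.
Qed.

Lemma pweight_prev z l p :
  pweight z l (prev p) = w p * z ^+ plen p * expR (- l * height (pstart p) (pend p)).
Proof.
rewrite /pweight (weight_reversible wgood) plen_prev pend_prev pstart_prev.
by rewrite heightC mulrN mulNr.
Qed.

Lemma pweight_join_factor z l p q : pend p = pstart q ->
  pweight z l p * pweight z l q = (w p * w q) * (z ^+ plen (pjoin p q) *
    expR (l * height (pstart p) (pend (pjoin p q)))).
Proof.
move=> e; rewrite /pweight (plen_join e) exprD (pend_join e).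
rewrite -(height_cocycle (pstart p) (pend p) (pend q)) -e mulrDr expRD.
move: (w p) (w q) (z ^+ plen p) (z ^+ plen q) (expR _) (expR _) => a b c d f g.
by ring.
Qed.

Lemma pweight_join_le z l p q : 0 <= z -> pend p = pstart q ->
  pweight z l (pjoin p q) <= pweight z l p * pweight z l q.
Proof.
move=> z0 e; rewrite (pweight_join_factor _ _ e) /pweight pstart_join -mulrA.
apply: ler_wpM2r; first by rewrite mulr_ge0 ?expR_ge0 ?exprn_ge0.
by rewrite (pjoinE e); apply: (weight_repulsive wgood).
Qed.

Lemma pweight_join z l p q : pend p = pstart q -> disjoint_paths p q ->
  pweight z l (pjoin p q) = pweight z l p * pweight z l q.
Proof.
move=> e d; rewrite (pweight_join_factor _ _ e) /pweight pstart_join -mulrA.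
by congr (_ * _); rewrite (pjoinE e); apply: (weight_zero_range wgood).
Qed.

Definition from (v : G) A : set (gpath G) := [set p | pstart p = v /\ A p].

Definition invariant_paths A := forall f p, Gam f -> A (pmap_aut f p) <-> A p.

Local Notation PSum v A z l := (\esum_(p in from v A) (pweight z l p)%:E)%E.

Lemma from_transport u v A (f : gpath G -> \bar R) :
  invariant_paths A -> (forall g p, Gam g -> f (pmap_aut g p) = f p) ->
  (\esum_(p in from u A) f p = \esum_(p in from v A) f p)%E.
Proof.
move=> Ainv finv; have [g Gg gu] := Gtr u v.
rewrite [RHS](reindex_esum (from u A) _ (pmap_aut g)).
  by apply: eq_esum => p _; rewrite finv.
split=> [p [sp Ap]|p q _ _ /pmap_inj//|p [sp Ap]].
  by split; [rewrite pmap_start sp | apply/Ainv].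
exists (pmap_aut (aut_inv g) p); last exact: pmap_invK.
split; first by rewrite pmap_start sp /= -gu avK.
by apply/Ainv => //; apply: subgroup_inv.
Qed.

Lemma psum_transport u v A z l : invariant_paths A -> PSum u A z l = PSum v A z l.
Proof. move=> Ai; apply: (from_transport _ _ Ai) => g p Gg; by rewrite (pweight_invariant _ _ _ Gg). Qed.

Lemma esum_fiber (T T' : choiceType) (P : set T) (k : T -> T') (f : T -> \bar R) :
  (forall t, P t -> (0 <= f t)%E) ->
  (\esum_(t in P) f t = \esum_(y in [set: T']) \esum_(t in [set t | P t /\ k t = y]) f t)%E.
Proof.
move=> f0; rewrite esum_esum => [|y t _ [Pt _]]; last exact: f0.
rewrite (reindex_esum P _ (fun t => (k t, t))) //.
split=> [t Pt|t t' _ _ [_ ->]//|[y t] [_ [Pt /= <-]]]; first by split.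
by exists t.
Qed.

(** Reversal exchanges the two endpoints; mass transport brings the starting
point back to [o] at the price of one factor Delta, which turns the tilt [- l]
of a reversed path into [1 - l]. *)
Lemma psum_reverse o A z l : 0 <= z -> invariant_paths A ->
  PSum o A z l = PSum o (fun p => A (prev p)) z (1 - l).
Proof.
move=> z0 Ai; have W0 l' p : (0 <= (pweight z l' p)%:E)%E by rewrite lee_fin pweight_ge0.
pose P x y := [set p | from x A p /\ pend p = y].
pose F x y := (\esum_(p in P x y) (pweight z l p)%:E)%E.
have Finv f x y : Gam f -> F (av f x) (av f y) = F x y.
  move=> Gf; rewrite /F (reindex_esum (P x y) _ (pmap_aut f)).
    by apply: eq_esum => p _; rewrite (pweight_invariant _ _ _ Gf).
  split=> [p [[sp Ap] ep]|p q _ _ /pmap_inj//|p [[sp Ap] ep]].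
    by split; [split; [rewrite pmap_start sp|apply/Ai]|rewrite pmap_end ep].
  exists (pmap_aut (aut_inv f) p); last exact: pmap_invK.
  split; [split|]; first by rewrite pmap_start sp /= avK.
    by apply/Ai => //; apply: subgroup_inv.
  by rewrite pmap_end ep /= avK.
rewrite (esum_fiber (@pend G)) //.
rewrite (mass_transport o (F := F)) //; last first.
  by move=> x y; rewrite /F; apply: esum_ge0 => p _; apply: W0.
rewrite [RHS](esum_fiber (@pend G)) //; apply: eq_esum => x _.
rewrite muleC -esumZl ?ltW ?modular_gt0 //.
rewrite (reindex_esum [set q | from o (fun p => A (prev p)) q /\ pend q = x] _ (@Defs.prev G)).
  apply: eq_esum => q [[sq _] eq]; rewrite -EFinM; congr EFin.
  rewrite pweight_prev modular_expR /pweight sq eq mulrCA -expRD.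
  by rewrite mulrBl mul1r mulNr.
split=> [q [[sq Aq] eq]|p q _ _ /(inv_inj (@prevK G))//|p [[sp Ap] ep]].
  by split; [split|]; rewrite ?pstart_prev ?pend_prev.
by exists (prev p); rewrite ?prevK //; split; [split|]; rewrite ?prevK ?pstart_prev ?pend_prev.
Qed.

Lemma psum_pairs v A (B : gpath G -> set (gpath G)) z l : 0 <= z ->
  (\esum_(q in from v A) ((pweight z l q)%:E * PSum (pend q) (B q) z l) =
   \esum_(k in from v A `*`` (fun q => from (pend q) (B q)))
     (pweight z l k.1 * pweight z l k.2)%:E)%E.
Proof.
move=> z0; have W0 p : (0 <= (pweight z l p)%:E)%E by rewrite lee_fin pweight_ge0.
rewrite -(esum_esum (a := fun q r => (pweight z l q * pweight z l r)%:E)).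
  apply: eq_esum => q _; rewrite -esumZl ?pweight_ge0 //.
by move=> q r _ _; rewrite lee_fin mulr_ge0 ?pweight_ge0.
Qed.

(** Repulsion bounds the weight of a path by those of its two pieces, and the
path is recovered from the pieces by joining them.  The set allowed for the
second piece may depend on the first. *)
Lemma psum_cut_le v T A (B : gpath G -> set (gpath G)) (k : gpath G -> nat) z l :
  0 <= z ->
  (forall p, T p -> [/\ (k p <= plen p)%N, A (ptake (k p) p) &
     B (ptake (k p) p) (pdrop (k p) p)]) ->
  (PSum v T z l <= \esum_(q in from v A)
     ((pweight z l q)%:E * PSum (pend q) (B q) z l))%E.
Proof.
move=> z0 h; have W0 p : (0 <= (pweight z l p)%:E)%E by rewrite lee_fin pweight_ge0.
rewrite psum_pairs //.
apply: (le_esum_inj (e := fun p => (ptake (k p) p, pdrop (k p) p))).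
- move=> p [sp /h[kp Ap Bp]]; split; first by split.
  by split.
- move=> p q _ _ e; rewrite -(pjoin_take_drop (k p) p) -(pjoin_take_drop (k q) q).
  exact: (congr1 (fun t => pjoin t.1 t.2) e).
- move=> p _ /=; rewrite lee_fin -{1}(pjoin_take_drop (k p) p).
  exact: pweight_join_le.
- by move=> [q r] _; rewrite lee_fin mulr_ge0 ?pweight_ge0.
Qed.

(** Conversely, joining disjoint pieces loses no weight, and it is injective as
soon as the cutting time can be read off the joined path. *)
Lemma psum_join_ge v T A (B : gpath G -> set (gpath G)) (k : gpath G -> nat) z l :
  0 <= z ->
  (forall q r, pend q = pstart r -> A q -> B q r ->
    [/\ T (pjoin q r), disjoint_paths q r & k (pjoin q r) = plen q]) ->
  (\esum_(q in from v A) ((pweight z l q)%:E * PSum (pend q) (B q) z l) <=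
   PSum v T z l)%E.
Proof.
move=> z0 h; have W0 p : (0 <= (pweight z l p)%:E)%E by rewrite lee_fin pweight_ge0.
rewrite psum_pairs //.
apply: (le_esum_inj (e := fun t => pjoin t.1 t.2)) => //.
- move=> [q r] /= [[sq Aq] [/esym sr Br]]; split; first by rewrite pstart_join.
  by have [] := h q r sr Aq Br.
- move=> [q r] [q' r'] /set_mem[[/= _ Aq] [/esym sr /= Br]].
  move=> /set_mem[[/= _ Aq'] [/esym sr' /= Br']] /= e.
  have [_ _ kq] := h q r sr Aq Br; have [_ _ kq'] := h q' r' sr' Aq' Br'.
  have eq_q : q = q' by rewrite -(ptake_join sr) -(ptake_join sr') -kq -kq' e.
  have -> : r = r' by rewrite -(pdrop_join sr) -(pdrop_join sr') -kq -kq' e.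
  by rewrite eq_q.
- move=> [q r] /= [[sq Aq] [/esym sr Br]]; have [_ d _] := h q r sr Aq Br.
  by rewrite lee_fin (pweight_join _ _ sr d).
Qed.

(** By transitivity the inner sum does not depend on the endpoint of the first
piece. *)
Lemma psum_prod v A B z l b : 0 <= z -> 0 <= b -> invariant_paths B ->
  PSum v B z l = b%:E ->
  (\esum_(q in from v A) ((pweight z l q)%:E * PSum (pend q) B z l) =
   b%:E * PSum v A z l)%E.
Proof.
move=> z0 b0 Bi Bb; rewrite -esumZl // => [|p _]; last first.
  by rewrite lee_fin pweight_ge0.
by apply: eq_esum => q _; rewrite (psum_transport (pend q) v) // Bb muleC.
Qed.

Definition len_le N : set (gpath G) := [set p | (plen p <= N)%N].
Definition len_eq n : set (gpath G) := [set p | plen p = n].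

Lemma invariant_len_le N : invariant_paths (len_le N).
Proof. by move=> f p _; rewrite /len_le /= pmap_len. Qed.

Lemma invariant_len_eq n : invariant_paths (len_eq n).
Proof. by move=> f p _; rewrite /len_eq /= pmap_len. Qed.

Lemma invariantI A B : invariant_paths A -> invariant_paths B ->
  invariant_paths (A `&` B).
Proof. by move=> hA hB f p Gf; split=> -[/(hA f p Gf) ? /(hB f p Gf) ?]. Qed.

Local Notation Z o l n := (Zw Gam o w l n).

Lemma psum_len_eq o z l n : 0 <= z -> PSum o (len_eq n) z l = (z ^+ n * Z o l n)%:E.
Proof.
move=> z0; have fin := finite_paths_len Glf o n.
rewrite /Zw /from /len_eq /= esum_fset => [|//|p _]; last first.
  by rewrite lee_fin pweight_ge0.
rewrite !fsbig_finite //= mulr_sumr sumEFin; congr EFin.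
rewrite big_seq [RHS]big_seq; apply: eq_bigr => p.
rewrite in_fset_set // inE => -[sp lp].
by rewrite modular_powR /pweight lp sp mulrCA mulrA.
Qed.

(** Truncated susceptibilities are finite sums, so real arithmetic applies. *)
Lemma psum_len_le o z l N : 0 <= z ->
  PSum o (len_le N) z l = (\sum_(n < N.+1) z ^+ n * Z o l n)%:E.
Proof.
move=> z0; have W0 p : (0 <= (pweight z l p)%:E)%E by rewrite lee_fin pweight_ge0.
rewrite (esum_fiber (@plen G)) //.
rewrite (esumID `I_N.+1) => [|n _]; last exact: esum_ge0.
rewrite [X in (_ + X)%E]esum1 ?adde0; last first.
  move=> n /= [_ nN]; rewrite (_ : [set _ | _] = set0) ?esum_set0 //.
  by apply/seteqP; split=> p //= [[_ pN] pn]; apply: nN; rewrite /= -pn.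
rewrite setTI esum_fset //; last by move=> n _; apply: esum_ge0.
rewrite -fsbig_ord -sumEFin; apply: eq_bigr => n _.
rewrite -psum_len_eq //; congr esum; apply/seteqP; split=> p /= [].
  by move=> [sp _] pn.
by move=> sp pn; split=> //; split=> //; rewrite /len_le /= pn -ltnS.
Qed.

Lemma Zw_ge0 o l n : 0 <= Z o l n.
Proof.
have := psum_len_eq o l n (@ler01 R); rewrite expr1n mul1r -lee_fin => <-.
by apply: esum_ge0 => p _; rewrite lee_fin pweight_ge0.
Qed.

Lemma Zw0 o l : Z o l 0 = 1.
Proof.
apply: EFin_inj; have := psum_len_eq o l 0 (@ler01 R); rewrite expr1n mul1r => <-.
rewrite (_ : from _ _ = [set pnil o]) ?esum_set1 ?pweight_nil //.
apply/seteqP; split=> p; last by move=> ->.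
by move=> [<- /plen0_nil].
Qed.

Lemma Zw_reverse o l n : Z o l n = Z o (1 - l) n.
Proof.
apply: EFin_inj; have /= e l' := psum_len_eq o l' n (@ler01 R).
move: (e l) (e (1 - l)); rewrite expr1n !mul1r => <- <-.
rewrite psum_reverse //; last exact: invariant_len_eq.
congr esum; apply/seteqP; split=> p [sp]; split=> //.
  by move: b; rewrite /len_eq /= plen_prev.
by rewrite /len_eq /= plen_prev.
Qed.

Lemma Zw_submul o l m n : Z o l (m + n) <= Z o l m * Z o l n.
Proof.
have /= e k := psum_len_eq o l k (@ler01 R).
have {}e k : PSum o (len_eq k) 1 l = (Z o l k)%:E by rewrite e expr1n mul1r.
rewrite -lee_fin EFinM -!e; apply: le_trans.
  apply: (@psum_cut_le o _ (len_eq m) (fun=> len_eq n) (fun=> m) 1 l) => //.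
  move=> p pmn; have mp : (m <= plen p)%N by rewrite pmn leq_addr.
  by split; rewrite /len_eq /= ?plen_take // plen_drop pmn addKn.
rewrite (psum_prod _ (b := Z o l n)) // ?e 1?muleC //; first exact: Zw_ge0.
exact: invariant_len_eq.
Qed.

End WeightedPathSums.

(** * Submultiplicative sequences and finite inequalities *)

Section RealSequences.
Context {R : realType}.
Implicit Types (a : nat -> R).

Lemma bernoulli (x : R) n : 0 <= x -> 1 + n%:R * x <= (1 + x) ^+ n.
Proof.
move=> x0; elim: n => [|n IHn]; first by rewrite mul0r addr0 expr0.
rewrite exprS; apply: (@le_trans _ _ ((1 + x) * (1 + n%:R * x))); last first.
  by rewrite ler_wpM2l // addr_ge0.
rewrite -natr1; have : 0 <= n%:R * x * x by rewrite !mulr_ge0.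
by nra.
Qed.

Lemma exp_unbounded (rho C : R) : 1 < rho -> exists N, forall n, (N <= n)%N -> C < rho ^+ n.
Proof.
move=> r1; have d0 : 0 < rho - 1 by rewrite subr_gt0.
exists (Num.truncn `|C / (rho - 1)|).+1 => n Nn.
have h : C / (rho - 1) < n%:R.
  apply: le_lt_trans (ler_norm _) _; apply: lt_le_trans (truncnS_gt _) _.
  by rewrite ler_nat.
have := bernoulli n (ltW d0); rewrite (_ : 1 + (rho - 1) = rho); last by ring.
apply: lt_le_trans; move: h; rewrite ltr_pdivrMr // => h.
by apply: lt_trans h _; rewrite ltrDr.
Qed.

Lemma powR_rootK (x : R) n : 0 <= x -> (0 < n)%N -> (x `^ n%:R^-1) ^+ n = x.
Proof.
move=> x0 n0; rewrite -powR_mulrn ?powR_ge0 // -powRrM mulVf ?powRr1 //.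
by rewrite pnatr_eq0 -lt0n.
Qed.

(** Letting [th] tend to 1, with the inverse of an explicit root of [S] in place
of a limit. *)
Lemma le_of_shrinking (S : R) N :
  (forall th, 0 < th -> th < 1 -> S * th ^+ N <= 1) -> S <= 1.
Proof.
move=> h; rewrite leNgt; apply/negP => S1.
have S0 : 0 < S by apply: lt_trans S1.
(* An (N + 1)-st root, so that its N-th power is still below [S]. *)
pose rho := S `^ N.+1%:R^-1.
have e : rho ^+ N.+1 = S by apply: powR_rootK; rewrite // ltW.
have r1 : 1 < rho.
  rewrite ltNge; apply/negP => h1.
  by have : S <= 1; [rewrite -e exprn_ile1 // powR_ge0 | rewrite leNgt S1].
have rS : rho ^+ N < S by rewrite -e exprS ltr_pMl // exprn_gt0 // (lt_trans _ r1).
have r0 : 0 < rho by apply: lt_trans r1.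
have := h rho^-1; rewrite invr_gt0 r0 invf_lt1 // => /(_ isT r1).
by rewrite exprVn ler_pdivrMr ?exprn_gt0 // mul1r leNgt rS.
Qed.

Section Submultiplicative.
Variables (a : nat -> R) (c : R).
Hypotheses (a0 : a 0%N = 1) (asub : forall m n, a (m + n)%N <= a m * a n).
Hypotheses (c0 : 0 < c) (ac : forall n, c ^+ n <= a n).

Let a_gt0 n : 0 < a n. Proof. by apply: lt_le_trans (ac n); rewrite exprn_gt0. Qed.

(** Euclidean division of the index by [k]. *)
Lemma submul_geometric rho k : (0 < k)%N -> 0 < rho -> a k <= rho ^+ k ->
  exists2 C, 0 < C & forall n, a n <= C * rho ^+ n.
Proof.
move=> k0 r0 ak; exists (\sum_(i < k) a i / rho ^+ i).
  rewrite (bigD1 (Ordinal k0)) //= ltr_pwDl ?divr_gt0 ?exprn_gt0 //.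
  by apply: sumr_ge0 => i _; rewrite divr_ge0 ?exprn_ge0 // ltW.
move=> n; have hq q r : a (q * k + r) <= rho ^+ (q * k) * a r.
  elim: q => [|q IHq]; first by rewrite mul0n add0n expr0 mul1r.
  rewrite mulSn -addnA exprD -mulrA; apply: le_trans (asub _ _) _.
  by apply: ler_pM => //; apply: ltW.
rewrite {1}(divn_eq n k); apply: le_trans (hq _ _) _.
rewrite [X in _ <= _ * rho ^+ X](divn_eq n k) exprD mulrCA.
rewrite ler_wpM2l ?exprn_ge0 ?(ltW r0) //.
rewrite -ler_pdivrMr ?exprn_gt0 //.
have lk := ltn_pmod n k0; rewrite (bigD1 (Ordinal lk)) //= ler_wpDr //.
by apply: sumr_ge0 => i _; rewrite divr_ge0 ?exprn_ge0 // ltW.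
Qed.

Let u n := a n `^ n%:R^-1.
(* Index 0 is left out: the exponent 0^-1 = 0 makes the root there equal to 1. *)
Let E := [set u n.+1 | n in [set: nat]].

Let u_ge n : c <= u n.+1.
Proof.
rewrite -(@ler_pXn2r _ n.+1) ?nnegrE ?powR_ge0 ?(ltW c0) //.
by rewrite powR_rootK // ltW.
Qed.

Let hasE : has_inf E.
Proof. by split; [exists (u 1), 0 | exists c => _ [n _ <-]]. Qed.

Let u_inf n : inf E <= u n.+1.
Proof. by apply: ge_inf; [case: hasE | exists n]. Qed.

Let inf_c : c <= inf E.
Proof. by apply: lb_le_inf; [case: hasE | move=> _ [n _ <-]]. Qed.

Let fekete_bound rho : inf E < rho -> exists2 C, 0 < C & forall n, a n <= C * rho ^+ n.
Proof.
move=> h; have [_ [k _ <-] uk] := inf_lt (proj1 hasE) h.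
have r0 : 0 < rho by apply: lt_trans h; apply: lt_le_trans inf_c.
apply: (@submul_geometric rho k.+1) => //.
rewrite -(@powR_rootK (a k.+1) k.+1) ?(ltW (a_gt0 _)) //.
by rewrite lerXn2r ?nnegrE ?powR_ge0 ?(ltW r0) //; exact: ltW uk.
Qed.

Lemma fekete_lim : limn u = inf E.
Proof.
apply: cvg_lim => //; apply/cvgrPdist_le => e e0.
have i0 : 0 < inf E by apply: lt_le_trans inf_c.
pose rho := inf E + e / 2.
have [|C C0 hC] := @fekete_bound rho; first by rewrite /rho ltrDl divr_gt0.
have r0 : 0 < rho by rewrite /rho addr_gt0 // divr_gt0.
have [N hN] := @exp_unbounded ((inf E + e) / rho) C
  ltac:(by rewrite ltr_pdivlMr // mul1r /rho ltrD2l ltr_pdivrMr // ltr_pMr // ltr1n).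
exists N.+1 => // n /= Nn; case: n Nn => // n Nn.
have h1 : u n.+1 <= inf E + e.
  rewrite -(@ler_pXn2r _ n.+1) ?nnegrE ?powR_ge0 //; last by rewrite addr_ge0 ?(ltW i0) ?(ltW e0).
  rewrite powR_rootK ?(ltW (a_gt0 _)) //; apply: le_trans (hC _) _.
  have := hN n.+1 (leq_trans (leqnSn N) Nn).
  by rewrite expr_div_n ltr_pdivlMr ?exprn_gt0 // => /ltW.
rewrite distrC ler_norml; have := u_inf n; lra.
Qed.

Lemma fekete_gt0 : 0 < limn u.
Proof. by rewrite fekete_lim; apply: lt_le_trans inf_c. Qed.

Lemma fekete_le n : limn u ^+ n <= a n.
Proof.
have l0 := fekete_gt0.
rewrite fekete_lim in l0 *; case: n => [|n]; first by rewrite expr0 a0.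
rewrite -(@powR_rootK (a n.+1) n.+1) ?(ltW (a_gt0 _)) //.
by rewrite lerXn2r ?nnegrE ?powR_ge0 ?(ltW l0) //; exact: u_inf.
Qed.

Lemma fekete_ge rho : limn u < rho -> exists2 C, 0 < C & forall n, a n <= C * rho ^+ n.
Proof. by rewrite fekete_lim; apply: fekete_bound. Qed.

End Submultiplicative.

(** If the average A_M / M exceeds 6 K then the hypothesis squares the ratio
to 6 K at each doubling of M, so that A grows exponentially, which contradicts
the subexponential growth of [a].  Hence the averages are bounded, some pair
(a_k, a_(n-k)) has a bounded sum, and submultiplicativity bounds a_n by the
product of its members. *)
Lemma bounded_of_doubling a (K : R) :
  a 0%N = 1 -> (forall n, 0 <= a n) -> (forall m n, a (m + n)%N <= a m * a n) ->
  (forall rho, 1 < rho -> exists2 C, 0 < C & forall n, a n <= C * rho ^+ n) ->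
  0 < K ->
  (forall M, (\sum_(n < M.+1) a n) ^+ 2 <= K * (2 * M + 1)%:R * \sum_(n < (2 * M).+1) a n) ->
  exists2 C, 0 < C & forall n, a n <= C.
Proof.
move=> a0 age asub sube K0 dbl; pose A M := \sum_(n < M.+1) a n.
have A0 M : 0 <= A M by apply: sumr_ge0.
(* 6 = 3 * 2: the 3 because 2 N + 1 <= 3 N, the 2 because A (2 N) is compared
   with 2 N. *)
have lin M : (0 < M)%N -> A M <= 6 * K * M%:R.
  move=> M0; rewrite leNgt; apply/negP => hM.
  have Mr : 0 < M%:R :> R by rewrite ltr0n.
  have KM : 0 < 6 * K * M%:R by rewrite !mulr_gt0.
  pose r := A M / (6 * K * M%:R); have r1 : 1 < r by rewrite ltr_pdivlMr // mul1r.
  have grow j : 6 * K * (2 ^ j * M)%:R * r ^+ (2 ^ j) <= A (2 ^ j * M)%N.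
    elim: j => [|j IHj].
      by rewrite expn0 mul1n expr1 mulrC divfK // gt_eqF.
    set N := (2 ^ j * M)%N in IHj *.
    have N1 : (0 < N)%N by rewrite muln_gt0 expn_gt0.
    have -> : (2 ^ j.+1 * M = 2 * N)%N by rewrite expnS mulnA.
    rewrite expnSr exprM.
    have x0 : 0 <= r ^+ (2 ^ j) by rewrite exprn_ge0 // ltW // (lt_trans _ r1).
    have := dbl N; rewrite -/(A N) -/(A (2 * N)%N).
    move: (r ^+ (2 ^ j)) IHj x0 => x IHj x0 dN.
    have N1r : 1 <= N%:R :> R by rewrite ler1n.
    have h1 : (6 * K * N%:R * x) ^+ 2 <= A N ^+ 2.
      by rewrite lerXn2r ?nnegrE // !mulr_ge0 // ltW.
    have h2 : K * (2 * N + 1)%:R * A (2 * N)%N <= 3 * K * N%:R * A (2 * N)%N.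
      rewrite ler_wpM2r // natrD natrM; have := ltW K0; nra.
    have h3 := le_trans h1 (le_trans dN h2).
    rewrite natrM; rewrite -(@ler_pM2l _ (3 * K * N%:R)); last first.
      by rewrite !mulr_gt0 // (lt_le_trans _ N1r).
    by apply: le_trans h3; rewrite le_eqVlt; apply/orP; left; apply/eqP; ring.
  pose rho := r `^ (2 * M)%:R^-1.
  have M2 : (0 < 2 * M)%N by rewrite muln_gt0.
  have r0 : 0 <= r by apply: ltW; apply: lt_trans r1.
  have rE : rho ^+ (2 * M) = r by apply: powR_rootK.
  have rho1 : 1 < rho.
    rewrite ltNge; apply/negP => h1.
    have : r <= 1 by rewrite -rE exprn_ile1 // powR_ge0.
    by rewrite leNgt r1.
  have rho0 : 0 < rho by apply: lt_trans rho1.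
  have [C C0 hC] := sube rho rho1.
  have [n0 hn0] := exp_unbounded (C / (3 * K)) rho1.
  pose N := (2 ^ n0 * M)%N.
  have Nn : (n0 <= N)%N.
    by apply: leq_trans (leq_pmulr _ M0); apply: ltnW; apply: ltn_expl.
  have N1 : (0 < N)%N by rewrite muln_gt0 expn_gt0.
  (* [grow] gives A N at least 6 K N rho ^ (2 N), which outgrows this. *)
  have up : A N <= 2 * N%:R * (C * rho ^+ N).
    apply: (@le_trans _ _ (\sum_(n < N.+1) (C * rho ^+ N))).
      apply: ler_sum => i _; apply: le_trans (hC _) _.
      by rewrite ler_wpM2l ?(ltW C0) // ler_weXn2l ?(ltW rho1) // -ltnS.
    rewrite sumr_const card_ord -[leLHS]mulr_natl ler_wpM2r //.
      by rewrite mulr_ge0 ?exprn_ge0 // ltW.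
    by rewrite -natrM ler_nat mul2n -addnn -addn1 leq_add2l.
  have := le_trans (grow n0) up; rewrite -/N -rE -exprM.
  have -> : (2 * M * 2 ^ n0 = N + N)%N by rewrite addnn -mul2n -mulnA [(M * _)%N]mulnC.
  rewrite exprD; have := hn0 N Nn; rewrite ltr_pdivrMr ?mulr_gt0 //.
  have : 0 < rho ^+ N by rewrite exprn_gt0.
  have : 0 < N%:R :> R by rewrite ltr0n.
  move: (rho ^+ N) (N%:R : R) => x y y0 x0 h1 h2.
  have : 0 < y * x * (x * (3 * K) - C) by rewrite !mulr_gt0 // subr_gt0.
  nra.
pose D := 6 * K + 1.
have D0 : 0 < D by rewrite /D; lra.
have AD n : A n <= D * n.+1%:R.
  case: n => [|n].
    by rewrite /A big_ord_recl big_ord0 a0 addr0 mulr1 /D; lra.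
  apply: le_trans (lin _ _) _ => //; rewrite /D -[n.+2%:R]natr1.
  have : 0 <= n.+1%:R :> R by []. 
  by move: K0; nra.
exists (D ^+ 2) => [|n]; first by rewrite exprn_gt0.
(* The mean of a k + a (n - k) over k <= n is at most 2 D. *)
have [k kn hk] : exists2 k, (k <= n)%N & a k + a (n - k)%N <= 2 * D.
  apply: contrapT => h; have : \sum_(k < n.+1) (2 * D) < \sum_(k < n.+1) (a k + a (n - k)%N).
    apply: ltr_sum => //; first by apply/hasP; exists ord0; rewrite // mem_index_enum.
    move=> [k kn] _ /=; rewrite ltNge; apply/negP => hk; apply: h.
    by exists k.
  rewrite big_split /= [X in _ < _ + X](reindex_inj rev_ord_inj) /=.
  rewrite [X in _ < _ + X](eq_bigr (fun i : 'I_n.+1 => a i)); last first.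
    by move=> i _; rewrite subSS subKn // -ltnS.
  rewrite -/(A n) sumr_const card_ord -[X in X < _]mulr_natl.
  by have := AD n; nra.
have := asub k (n - k)%N; rewrite subnKC // => h; apply: le_trans h _.
have := age k; have := age (n - k)%N; move: (a k) (a (n - k)%N) hk => x y hk y0 x0.
have := sqr_ge0 (x - y); nra.
Qed.

(** A discrete Gronwall inequality.  Removing an item of largest [t] leaves the
other inner sums unchanged, since that item belongs to none of them. *)
Lemma gronwall_sum (T : eqType) (r : seq T) (t b : T -> R) s :
  (forall i, 0 <= b i) ->
  1 + \sum_(i <- r | t i < s) b i * expR (\sum_(j <- r | t j < t i) b j) <=
  expR (\sum_(i <- r | t i < s) b i).
Proof.
move=> b0; have [n] := ubnP (size r); elim: n r s => // n IHn r s.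
case: r => [|x r] sz; first by rewrite !big_nil expR0 addr0.
have [m mr mmax] : exists2 m, m \in x :: r & forall j, j \in x :: r -> t j <= t m.
  elim: (r) => [|y r' [m mr hm]].
    by exists x; rewrite ?mem_head // => j; rewrite inE => /eqP ->.
  have [ym|my] := leP (t y) (t m).
    exists m => [|j]; first by move: mr; rewrite !inE => /orP[->|->]; rewrite ?orbT.
    by rewrite !inE => /or3P[jx|/eqP->//|jr]; apply: hm; rewrite inE ?jx ?jr ?orbT.
  exists y; first by rewrite !inE eqxx orbT.
  move=> j; rewrite !inE => /or3P[jx|/eqP->//|jr]; apply: le_trans (ltW my);
    by apply: hm; rewrite inE ?jx ?jr ?orbT.
have pr := perm_to_rem mr; set r' := rem m (x :: r) in pr.
have sz' : (size r' < n)%N by rewrite /r' size_rem //= -ltnS.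
have mr' j : j \in r' -> t j <= t m.
  by move=> jr; apply: mmax; rewrite (perm_mem pr) inE jr orbT.
have inner u : \sum_(i <- x :: r | t i < u) b i =
    (if t m < u then b m else 0) + \sum_(i <- r' | t i < u) b i.
  by rewrite (perm_big _ pr) /= big_cons; case: ifP; rewrite ?add0r.
rewrite (perm_big _ pr) /= big_cons (inner s) inner ltxx add0r.
have -> : \sum_(j <- r' | t j < s) b j * expR (\sum_(j0 <- x :: r | t j0 < t j) b j0) =
    \sum_(j <- r' | t j < s) b j * expR (\sum_(j0 <- r' | t j0 < t j) b j0).
  rewrite big_seq_cond [RHS]big_seq_cond; apply: eq_bigr => j /andP[jr _].
  by rewrite inner ltNge mr' //= add0r.
have IH := IHn r' s sz'.
case: ifP => ms; last by rewrite add0r.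
rewrite expRD addrCA; apply: (@le_trans _ _
  (b m * expR (\sum_(i <- r' | t i < s) b i) + expR (\sum_(i <- r' | t i < s) b i))).
  apply: lerD => //; rewrite ler_wpM2l // ler_expR.
  rewrite big_mkcond [leRHS]big_mkcond /=; apply: ler_sum => j _.
  by case: ifP => jm; [rewrite (lt_trans jm ms) | case: ifP].
rewrite -[X in _ + X]mul1r -mulrDl ler_wpM2r ?expR_ge0 // addrC.
exact: expR_ge1Dx.
Qed.

End RealSequences.

(** * Heights of edges and growth rates *)

Section GrowthRates.
Context {R : realType} (G : mgraph) (Gam : set (gaut G)) {act : transitive_action Gam}.
Context (w : gpath G -> R) {wgood : good_weight Gam w}.

Let Gconn : connected_graph G := action_connected.
Let Glf : locally_finite G := action_locally_finite.
Let Gtr : transitive_aut Gam := action_transitive.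

Local Notation height := (@height R G Gam).
Local Notation pweight := (pweight Gam w).
Local Notation PSum v A z l := (\esum_(p in from v A) (pweight z l p)%:E)%E.
Local Notation Z o l n := (Zw Gam o w l n).

Lemma gdist_path x y : exists2 p : gpath G, pstart p = x /\ pend p = y & plen p = gdist x y.
Proof.
rewrite /gdist; case: pselect => [h|[]].
  by case: ex_minnP => n /asboolP[p [? ? ?]] _; exists p.
by have [p [sp ep]] := Gconn x y; exists (plen p); apply/asboolP; exists p.
Qed.

Lemma gdist_le (p : gpath G) : (gdist (pstart p) (pend p) <= plen p)%N.
Proof.
have hp : has_path_of_length (pstart p) (pend p) (plen p) by apply/asboolP; exists p.
rewrite /gdist; case: pselect => [h|[]]; last by exists (plen p).
by case: ex_minnP => n _; apply.
Qed.

Definition edge_height (e : dart G) := height (src e) (tgt e).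

Lemma edge_height_transport (e : dart G) v : exists2 e', src e' = v &
  edge_height e' = edge_height e.
Proof.
have [f Gf fv] := Gtr (src e) v; exists (ad f e); first by rewrite src_ad.
by rewrite /edge_height src_ad tgt_ad height_invariant.
Qed.

Lemma edge_height_rev (e : dart G) : edge_height (rev_dart e) = - edge_height e.
Proof. by rewrite /edge_height src_rev tgt_rev heightC. Qed.

(** By transitivity every edge height occurs among the finitely many edges
leaving one vertex. *)
Lemma edge_height_bounded : exists2 L : R, 0 < L & forall e, `|edge_height e| <= L.
Proof.
have [[v]|no] := pselect (exists v : G, True); last first.
  by exists 1 => // e; case: no; exists (src e).
move=> _; have finD := Glf v.
pose L := \sum_(e \in [set e : dart G | src e = v]) `|edge_height e|.
have L0 : 0 <= L by rewrite /L fsbig_finite //=; apply: sumr_ge0.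
exists (L + 1) => [|e]; first by rewrite ltr_wpDl.
have [e' ev <-] := edge_height_transport e v.
rewrite ler_wpDr // /L fsbig_finite //=.
rewrite (big_fsetD1 e') /=; last by rewrite in_fset_set // inE.
by rewrite lerDl; apply: sumr_ge0.
Qed.

Lemma height_walk_le (L : R) (p : gpath G) i : (forall e, `|edge_height e| <= L) ->
  (i <= plen p)%N -> `|height (pstart p) (pvertex p i)| <= L * i%:R.
Proof.
move=> hL; elim: i => [|i IHi] ip; first by rewrite pvertex0 height_refl normr0 mulr0.
have e : height (pstart p) (pvertex p i.+1) =
    height (pstart p) (pvertex p i) + height (pvertex p i) (pvertex p i.+1).
  by rewrite height_cocycle.
have [d [sd td]] : exists d : dart G, src d = pvertex p i /\ tgt d = pvertex p i.+1.
  pose q := ptake 1 (pdrop i p).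
  have lq : plen q = 1%N by rewrite plen_take // plen_drop subn_gt0.
  have sq : pstart q = pvertex p i by rewrite pstart_take pstart_drop // ltnW.
  have eq : pend q = pvertex p i.+1.
    by rewrite pend_take ?plen_drop ?subn_gt0 // pvertex_drop addn1.
  have := valP q; rewrite -/(pstart q) -/(pdarts q).
  move: lq eq; rewrite /pend /walk_end /plen.
  case: (pdarts q) => [|d [|//]] //= _ td /andP[/eqP sd _].
  by exists d; rewrite sd sq.
rewrite e -natr1 mulrDr mulr1; apply: le_trans (ler_normD _ _) _.
by apply: lerD; [apply/IHi/ltnW | rewrite -sd -td; apply: hL].
Qed.

Lemma height_le_gdist (L : R) x y : (forall e, `|edge_height e| <= L) ->
  `|height x y| <= L * (gdist x y)%:R.
Proof.
move=> hL; have [p [<- <-] <-] := gdist_path x y.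
by rewrite -pvertex_plen; apply: height_walk_le.
Qed.

(** If all edges were level, then so would be all pairs of vertices.  An edge
that is not level, its reversal and their translates supply both directions at
every vertex. *)
Lemma climbing_edge : ~ unimodular R Gam -> exists2 d : R, 0 < d &
  forall s : R, s ^+ 2 = 1 -> forall v, exists2 e, src e = v & s * edge_height e = d.
Proof.
move=> nonuni.
have [e e0] : exists e : dart G, edge_height e != 0.
  apply: contrapT => no; apply: nonuni => x y.
  have hL e : `|edge_height e| <= 0.
    by rewrite normr_le0; apply: contrapT => /negP ?; apply: no; exists e.
  have := height_le_gdist x y hL; rewrite mul0r normr_le0 => /eqP h.
  by rewrite modular_expR h expR0.
exists `|edge_height e|; first by rewrite normr_gt0.
move=> s s1 v; have [e1 e1v h1] := edge_height_transport e v.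
have [e2 e2v h2] := edge_height_transport (rev_dart e) v.
rewrite edge_height_rev in h2.
have : (s - 1) * (s + 1) = 0 by rewrite -subr_sqr s1 expr1n subrr.
move=> /eqP; rewrite mulf_eq0 => /orP[]/eqP hs.
  have -> : s = 1 by lra.
  have [eh|eh] := leP 0 (edge_height e).
    by exists e1; rewrite // mul1r h1 ?ger0_norm.
  by exists e2; rewrite // mul1r h2 ?ltr0_norm.
have -> : s = -1 by lra.
have [eh|eh] := leP 0 (edge_height e).
  by exists e2; rewrite // h2 ?ger0_norm // mulN1r opprK.
by exists e1; rewrite // h1 mulN1r ?ltr0_norm.
Qed.

(** A path with strictly monotone heights never revisits a vertex, so by the
zero-range property its weight is the product of the weights of its edges. *)
Lemma monotone_path (d s : R) : 0 < d ->
  (forall v, exists2 e, src e = v & s * edge_height e = d) ->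
  forall n v, exists p : gpath G, [/\ pstart p = v, plen p = n,
    (forall i, (i <= n)%N -> s * height v (pvertex p i) = i%:R * d) & 1 <= w p].
Proof.
move=> d0 hs; elim=> [|n IHn] v.
  exists (pnil v); split=> // [i|]; last by rewrite (weight_length0 wgood).
  by rewrite leqn0 => /eqP ->; rewrite pvertex0 height_refl mulr0 mul0r.
have [p [sp lp hp wp]] := IHn v.
have [e se he] := hs (pend p).
have c : pend p = pstart (pedge e) by rewrite /pstart /= se.
have hend : s * height v (pend p) = n%:R * d by rewrite -pvertex_plen lp hp.
have lj : plen (pjoin p (pedge e)) = n.+1 by rewrite plen_join // lp addn1.
have hl : s * height v (pend (pedge e)) = n.+1%:R * d.
  rewrite -(height_cocycle v (pend p)) mulrDr hend -natr1 mulrDl mul1r -he.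
  by rewrite /edge_height se.
exists (pjoin p (pedge e)); split=> //; first by rewrite pstart_join.
  move=> i; rewrite leq_eqVlt => /orP[/eqP ->|].
    by rewrite -lj pvertex_plen pend_join // lj.
  by rewrite ltnS => iN; rewrite pvertex_joinl ?lp // hp.
rewrite (pjoinE c) (weight_zero_range wgood).
  by rewrite -[1]mulr1 ler_pM //; apply: (weight_length1 wgood).
move=> i j ip /andP[j0 j1] ij.
have je : j = plen (pedge e) by apply/eqP; rewrite eqn_leq j1 j0.
have := hp i; rewrite -lp => /(_ (ltnW ip)).
rewrite ij je pvertex_plen hl => /eqP; rewrite -subr_eq0 -mulrBl mulf_eq0 => /orP[].
  rewrite subr_eq0 eqr_nat -lp => /eqP ni; by move: ip; rewrite -ni ltnNge leqnSn.
by rewrite gt_eqF.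
Qed.

Section Rates.
Variables (o : G) (l : R).
Hypothesis nonuni : ~ unimodular R Gam.

Lemma pweight_le_Zw n p : pstart p = o -> plen p = n -> pweight 1 l p <= Z o l n.
Proof.
move=> sp lp; have := psum_len_eq (Gam := Gam) (w := w) o l n (@ler01 R); rewrite expr1n mul1r => e.
rewrite -lee_fin -e -(@esum_set1 R _ p (fun q => (pweight 1 l q)%:E)); last first.
  by rewrite lee_fin pweight_ge0.
apply: le_esum_subset => [q ->//|q _]; by rewrite lee_fin pweight_ge0.
Qed.

(** This makes the growth rate positive. *)
Lemma Zw_ge_exp : exists2 c : R, 0 < c & forall n, c ^+ n <= Z o l n.
Proof.
have [d d0 hd] := climbing_edge nonuni.
exists (expR (l * d)) => [|n]; first exact: expR_gt0.
have h1 := hd 1 (expr1n _ _).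
have [p [sp lp hp wp]] := monotone_path d0 h1 n o.
apply: le_trans (pweight_le_Zw sp lp); rewrite /pweight expr1n mulr1.
have := hp n (leqnn n); rewrite mul1r -{1}lp pvertex_plen sp => ->.
rewrite -expRM_natl mulrCA ler_peMl ?expR_ge0 //.
Qed.

Local Notation mu := (mu_c Gam o w l).

Lemma Zw_gt0 n : 0 < Z o l n.
Proof. by have [c c0 hc] := Zw_ge_exp; apply: lt_le_trans (hc n); rewrite exprn_gt0. Qed.

Lemma mu_c_gt0 : 0 < mu.
Proof.
by have [c c0 hc] := Zw_ge_exp; apply: fekete_gt0 c0 hc; exact: Zw_submul.
Qed.

Lemma mu_c_le n : mu ^+ n <= Z o l n.
Proof.
by have [c c0 hc] := Zw_ge_exp; apply: fekete_le c0 hc _; [exact: Zw0|exact: Zw_submul].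
Qed.

Lemma Zw_le_geometric rho : mu < rho ->
  exists2 C, 0 < C & forall n, Z o l n <= C * rho ^+ n.
Proof.
by have [c c0 hc] := Zw_ge_exp; apply: fekete_ge c0 hc _; exact: Zw_submul.
Qed.

Lemma chi_psum z : 0 <= z -> chi Gam o w z l = PSum o setT z l.
Proof.
move=> z0; have Z0 n : (0 <= (z ^+ n * Z o l n)%:E)%E.
  by rewrite lee_fin mulr_ge0 ?exprn_ge0 ?Zw_ge0.
rewrite /chi nneseries_esumT // (esum_fiber (@plen G)); last first.
  by move=> p _; rewrite lee_fin pweight_ge0.
apply: eq_esum => n _; rewrite -psum_len_eq //; congr esum.
by apply/seteqP; split=> p [] // [].
Qed.

Lemma chi_le z (M : R) : 0 <= z -> (forall N, \sum_(n < N) z ^+ n * Z o l n <= M) ->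
  (chi Gam o w z l <= M%:E)%E.
Proof.
move=> z0 hM; apply: lime_le.
  by apply: is_cvg_nneseries => n _ _; rewrite lee_fin mulr_ge0 ?exprn_ge0 ?Zw_ge0.
by apply: nearW => N; rewrite sumEFin lee_fin big_mkord.
Qed.

Lemma geometric_le (q : R) N : 0 <= q -> q < 1 -> \sum_(n < N) q ^+ n <= (1 - q)^-1.
Proof.
move=> q0 q1; have e := subrX1 q N.
have p : 0 < 1 - q by rewrite subr_gt0.
rewrite -[leRHS]mul1r ler_pdivlMr //.
have : 0 <= q ^+ N by rewrite exprn_ge0.
move: e; move: (\sum_(n < N) q ^+ n) (q ^+ N) => S x; nra.
Qed.

(** The root test. *)
Lemma chi_subcritical z : 0 <= z -> z < z_c Gam o w l ->
  exists M : R, (chi Gam o w z l <= M%:E)%E.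
Proof.
have m0 := mu_c_gt0; move=> z0; rewrite /z_c => zc.
have zm : z * mu < 1 by rewrite -ltr_pdivlMr // div1r.
have [rho mrho zr] : exists2 rho, mu < rho & z * rho < 1.
  exists (mu + (1 - z * mu) / (2 * (z + 1))).
    by rewrite ltrDl divr_gt0 ?subr_gt0 // mulr_gt0 // ltr_wpDl.
  rewrite mulrDr -ltrBrDl mulrA ltr_pdivrMr; last by rewrite mulr_gt0 // ltr_wpDl.
  have : 0 < 1 - z * mu by rewrite subr_gt0.
  by move: (1 - z * mu) => x; nra.
have r0 : 0 <= rho by apply: ltW; apply: lt_trans mrho.
have [C C0 hC] := Zw_le_geometric mrho.
exists (C * (1 - z * rho)^-1); apply: chi_le => // N.
apply: (@le_trans _ _ (\sum_(n < N) C * (z * rho) ^+ n)).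
  apply: ler_sum => n _; rewrite exprMn mulrCA ler_wpM2l ?exprn_ge0 //.
rewrite -mulr_sumr ler_wpM2l ?(ltW C0) // geometric_le // mulr_ge0 //.
Qed.

End Rates.

Lemma mu_c_reverse o l : mu_c Gam o w (1 - l) = mu_c Gam o w l.
Proof.
have e : Zw Gam o w (1 - l) = Zw Gam o w l by apply/funext => n; rewrite -Zw_reverse.
by rewrite /mu_c e.
Qed.

End GrowthRates.

(** * Bridges and their renewal equation *)

Section Bridges.
Context {R : realType} (G : mgraph) (Gam : set (gaut G)) {act : transitive_action Gam}.
Context (w : gpath G -> R) {wgood : good_weight Gam w}.

Local Notation height := (@height R G Gam).
Local Notation pweight := (pweight Gam w).
Local Notation PSum v A z l := (\esum_(p in from v A) (pweight z l p)%:E)%E.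
Local Notation Z o l n := (Zw Gam o w l n).
Implicit Types (p q r : gpath G) (s t z l : R).

Definition rise p i : R := height (pstart p) (pvertex p i).

Lemma rise0 p : rise p 0 = 0.
Proof. by rewrite /rise pvertex0 height_refl. Qed.

Lemma height_rise p : height (pstart p) (pend p) = rise p (plen p).
Proof. by rewrite /rise pvertex_plen. Qed.

Lemma rise_take p k i : (i <= k <= plen p)%N -> rise (ptake k p) i = rise p i.
Proof. by move=> ikp; rewrite /rise pvertex_take. Qed.

Lemma rise_drop p k i : (k + i <= plen p)%N ->
  rise (pdrop k p) i = rise p (k + i) - rise p k.
Proof.
move=> kip; have kp := leq_trans (leq_addr i k) kip.
rewrite /rise pvertex_drop // pstart_drop //.
by rewrite -(height_cocycle (pstart p) (pvertex p k) (pvertex p (k + i))) addrC addKr.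
Qed.

Lemma rise_joinl p q i : pend p = pstart q -> (i <= plen p)%N ->
  rise (pjoin p q) i = rise p i.
Proof. by move=> e ip; rewrite /rise pvertex_joinl // pstart_join. Qed.

Lemma rise_joinr p q i : pend p = pstart q -> (i <= plen q)%N ->
  rise (pjoin p q) (plen p + i) = rise p (plen p) + rise q i.
Proof.
move=> e iq; rewrite /rise pvertex_joinr // pstart_join -e pvertex_plen.
by rewrite height_cocycle.
Qed.

Lemma rise_prev p i : (i <= plen p)%N ->
  rise (prev p) i = rise p (plen p - i) - rise p (plen p).
Proof.
move=> ip; rewrite /rise pvertex_prev // pstart_prev pvertex_plen.
by rewrite -(height_cocycle (pend p) (pstart p)) heightC addrC.
Qed.

Lemma rise_map f p i : Gam f -> rise (pmap_aut f p) i = rise p i.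
Proof. by move=> Gf; rewrite /rise pmap_vertex pmap_start height_invariant. Qed.

Definition nonempty_path : set (gpath G) := [set p | (0 < plen p)%N].

(** The lower end is strict and the upper end weak, so that two bridges joined
end to end share only the joining vertex and form a bridge again. *)
Definition bridge s : set (gpath G) := [set p |
  forall i, (0 < i <= plen p)%N -> 0 < s * rise p i <= s * rise p (plen p)].

(** The times at which a bridge can be cut into two bridges. *)
Definition cut_time s p k : Prop := [/\ (0 < k <= plen p)%N,
  (forall i, (i <= k)%N -> s * rise p i <= s * rise p k) &
  (forall i, (k < i <= plen p)%N -> s * rise p k < s * rise p i)].

Definition irreducible_bridge s : set (gpath G) := [set p |
  [/\ bridge s p, (0 < plen p)%N & forall k, (k < plen p)%N -> ~ cut_time s p k]].

Lemma invariant_nonempty : invariant_paths Gam nonempty_path.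
Proof. by move=> f p _; rewrite /nonempty_path /= pmap_len. Qed.

Lemma invariant_bridge s : invariant_paths Gam (bridge s).
Proof.
by move=> f p Gf; rewrite /bridge /= pmap_len; split=> h i /h; rewrite !rise_map.
Qed.

Lemma bridge_end_gt0 s p : bridge s p -> (0 < plen p)%N -> 0 < s * rise p (plen p).
Proof. by move=> bp p0; have /andP[] := bp (plen p) ltac:(by rewrite p0 leqnn). Qed.

Lemma bridge_le_end s p i : bridge s p -> (i <= plen p)%N ->
  s * rise p i <= s * rise p (plen p).
Proof.
case: i => [|i] bp ip; last by have /andP[] := bp i.+1 ip.
rewrite rise0 mulr0; case: (posnP (plen p)) => [->|p0]; first by rewrite rise0 mulr0.
by rewrite ltW // bridge_end_gt0.
Qed.

Lemma bridge_cut_end s p : bridge s p -> (0 < plen p)%N -> cut_time s p (plen p).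
Proof.
move=> bp p0; split=> [|i ip|i /andP[ip pi]]; first by rewrite p0 leqnn.
  exact: bridge_le_end.
by move: (leq_trans ip pi); rewrite ltnn.
Qed.

Definition first_cut s p : nat :=
  if pselect (exists k, `[< cut_time s p k >]) is left h then ex_minn h else 0%N.

Lemma first_cutP s p : bridge s p -> (0 < plen p)%N ->
  cut_time s p (first_cut s p) /\ forall k, cut_time s p k -> (first_cut s p <= k)%N.
Proof.
move=> bp p0; rewrite /first_cut; case: pselect => [h|[]]; last first.
  by exists (plen p); apply/asboolP; apply: bridge_cut_end.
case: ex_minnP => k /asboolP ck mk; split=> // j cj; apply: mk; exact/asboolP.
Qed.

Lemma first_cut_split s p : bridge s p -> (0 < plen p)%N ->
  [/\ (0 < first_cut s p <= plen p)%N,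
      irreducible_bridge s (ptake (first_cut s p) p) &
      bridge s (pdrop (first_cut s p) p)].
Proof.
move=> bp p0; have [[k0p kle klt] kmin] := first_cutP bp p0.
move: (first_cut s p) k0p kle klt kmin => k /andP[k0 kp] kle klt kmin.
split; first by rewrite k0 kp.
  split; rewrite ?plen_take //.
    move=> i; rewrite plen_take // => /andP[i0 ik].
    rewrite !rise_take ?leqnn ?ik // kle // andbT.
    by have /andP[] := bp i ltac:(by rewrite i0 (leq_trans ik kp)).
  move=> j jk [/andP[j0 jk']]; rewrite plen_take // in jk' * => jle jlt.
  have : (k <= j)%N; last by rewrite leqNgt jk.
  apply: kmin; split; first by rewrite j0 (leq_trans jk' kp).
    move=> i ij; have := jle i ij; rewrite !rise_take ?jk' //.
    by rewrite (leq_trans ij jk').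
  move=> i /andP[ji ip]; have [ik|ki] := leqP i k.
    by have := jlt i; rewrite !rise_take ?jk' ?ik //; apply; rewrite ji ?ik.
  have h1 := jlt k; rewrite !rise_take ?jk' ?leqnn ?kp // in h1.
  by apply: (lt_trans (h1 _)); rewrite ?jk ?leqnn //; apply: klt; rewrite ki ip.
move=> i; rewrite plen_drop => /andP[i0 ik].
have kip : (k + i <= plen p)%N by rewrite -leq_subRL.
rewrite !rise_drop ?subnKC // !mulrBr subr_gt0 lerD2r.
rewrite klt ?bridge_le_end //; first by rewrite -addn1 leq_add2l i0.
Qed.

(** The heights of the two pieces lie on opposite sides of the height of the
joining vertex: this makes them disjoint, and makes that vertex the first cut. *)
Lemma irreducible_join s q r : pend q = pstart r ->
  irreducible_bridge s q -> bridge s r ->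
  [/\ bridge s (pjoin q r), disjoint_paths q r & first_cut s (pjoin q r) = plen q].
Proof.
move=> e [bq q0 qcut] br.
have hl i : (i <= plen q)%N -> rise (pjoin q r) i = rise q i by apply: rise_joinl.
have hr j : (j <= plen r)%N ->
  rise (pjoin q r) (plen q + j) = rise q (plen q) + rise r j by apply: rise_joinr.
have lj := plen_join e.
have q_lt := bridge_end_gt0 bq q0.
have split_idx i : (i <= plen (pjoin q r))%N -> (i <= plen q)%N \/
    exists2 j, (0 < j <= plen r)%N & i = (plen q + j)%N.
  rewrite lj => ilj; have [iq|qi] := leqP i (plen q); first by left.
  by right; exists (i - plen q)%N; [lia|lia].
have r_ge j : (j <= plen r)%N -> 0 <= s * rise r j.
  case: j => [|j] jr; first by rewrite rise0 mulr0.
  by have /andP[/ltW] := br j.+1 jr.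
have endr : s * rise (pjoin q r) (plen (pjoin q r)) =
    s * rise q (plen q) + s * rise r (plen r) by rewrite lj hr // mulrDr.
have bj : bridge s (pjoin q r).
  move=> i /andP[i0 ij]; rewrite endr; case: (split_idx i ij) => [iq|[j /andP[j0 jr] ->]].
    rewrite hl //; have /andP[-> h] := bq i ltac:(by rewrite i0 iq).
    by rewrite ler_wpDr // r_ge.
  rewrite hr // mulrDr lerD2l bridge_le_end // andbT ltr_pwDl //.
  exact: r_ge.
have cq : cut_time s (pjoin q r) (plen q).
  split; first by rewrite q0 lj leq_addr.
    by move=> i iq; rewrite !hl //; apply: bridge_le_end.
  move=> i /andP[qi ij]; case: (split_idx i ij) => [|[j /andP[j0 jr] ->]].
    by rewrite leqNgt qi.
  rewrite hl // hr // mulrDr ltrDl.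
  by have /andP[] := br j ltac:(by rewrite j0 jr).
split=> //.
  move=> i j iq /andP[j0 jr] ij.
  have h1 := bridge_le_end bq (ltnW iq).
  have /andP[h2 _] := br j ltac:(by rewrite j0 jr).
  have h3 : rise q i = rise q (plen q) + rise r j.
    by rewrite -hr // /rise pvertex_joinr // pstart_join ij.
  by move: h1; rewrite h3 mulrDr; lra.
have [cf mf] := first_cutP bj ltac:(by rewrite lj ltn_addr).
apply/eqP; rewrite eqn_leq mf //= leqNgt; apply/negP => fq.
apply: (qcut _ fq); case: cf => /andP[f0 fj] fle flt.
split; first by rewrite f0 ltnW.
  by move=> i fi; have := fle i fi; rewrite !hl ?(ltnW fq) // (leq_trans fi (ltnW fq)).
move=> i /andP[fi iq]; have := flt i; rewrite !hl ?(ltnW fq) //; apply.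
by rewrite fi lj (leq_trans iq) // leq_addr.
Qed.

Section Renewal.
Variables (o : G) (s z l : R).
Hypothesis z0 : 0 <= z.

Let W0 p : (0 <= (pweight z l p)%:E)%E. Proof. by rewrite lee_fin pweight_ge0. Qed.

Lemma psum_nonempty A : A (pnil o) ->
  (PSum o A z l = 1 + PSum o (A `&` nonempty_path) z l)%E.
Proof.
move=> Anil; rewrite (esumID [set p | plen p = 0%N]) //; congr (_ + _)%E.
  rewrite (_ : _ `&` _ = [set pnil o]) ?esum_set1 ?pweight_nil //.
  by apply/seteqP; split=> [p [[<- _] /plen0_nil]|p ->].
congr esum; apply/seteqP; split=> p.
  by move=> [[sp Ap] /= /eqP]; rewrite -lt0n.
by move=> [sp [Ap p0]]; split=> //= pe; move: p0; rewrite /nonempty_path /= pe.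
Qed.

Lemma bridge_nil v : bridge s (pnil v).
Proof. by move=> i /= /andP[i0]; rewrite leqn0 => /eqP i1; rewrite i1 in i0. Qed.

(** With B the sum over bridges, [irreducible_join] gives 1 + I B <= B, where B
is finite. *)
Lemma irreducible_le1 (M : R) : (PSum o setT z l <= M%:E)%E ->
  (PSum o (irreducible_bridge s) z l <= 1)%E.
Proof.
move=> hM; set I := (PSum o (irreducible_bridge s) z l).
have bM : (PSum o (bridge s) z l <= M%:E)%E.
  by apply: le_trans hM; apply: le_esum_subset => // p [].
have bE := psum_nonempty (@bridge_nil o).
have b0 : (0 <= PSum o (bridge s `&` nonempty_path) z l)%E by apply: esum_ge0.
have [b bb] : exists b : R, PSum o (bridge s) z l = b%:E.
  exists (fine (PSum o (bridge s) z l)); rewrite fineK // ge0_fin_numE ?esum_ge0 //.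
  exact: le_lt_trans bM (ltry _).
have b1 : 1 <= b by rewrite -lee_fin -bb bE leeDl.
have step : (b%:E * I <= PSum o (bridge s `&` nonempty_path) z l)%E.
  rewrite -(psum_prod _ z0 _ (@invariant_bridge s) bb) ?(le_trans ler01) //.
  apply: (@psum_join_ge _ _ _ _ _ _ o _ _ (fun=> bridge s) (first_cut s)) => // q r e iq br.
  have [bj d c] := irreducible_join e iq br; split=> //; split=> //.
  by rewrite /nonempty_path /= plen_join // ltn_addr //; case: iq.
have lt_b : (b%:E * I < b%:E * 1)%E.
  apply: le_lt_trans step _; rewrite mule1 -bb bE.
  have : PSum o (bridge s `&` nonempty_path) z l \is a fin_num.
    rewrite ge0_fin_numE //; apply: le_lt_trans (ltry b); rewrite -bb bE.
    by rewrite leeDr.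
  by move=> /fineK <-; rewrite -EFinD lte_fin ltrDr.
by move: lt_b; rewrite lte_pmul2l ?lte_fin ?(lt_le_trans ltr01) // => /ltW.
Qed.

Lemma psum_prod_le v A B b : 0 <= b -> invariant_paths Gam B ->
  (PSum v B z l <= b%:E)%E ->
  (\esum_(q in from v A) ((pweight z l q)%:E * PSum (pend q) B z l) <=
   b%:E * PSum v A z l)%E.
Proof.
move=> b0 Bi Bb; rewrite -esumZl //; apply: le_esum => q _.
by rewrite (psum_transport (pend q) v) // muleC lee_wpmul2r.
Qed.

(** Cutting at the first cut time gives B_(N+1) <= 1 + I B_N for bridges of
length at most N; the truncation keeps the quantities finite. *)
Lemma bridge_le_geometric (iota : R) : iota < 1 ->
  (PSum o (irreducible_bridge s) z l <= iota%:E)%E ->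
  forall N, (PSum o (bridge s `&` len_le N) z l <= ((1 - iota)^-1)%:E)%E.
Proof.
move=> i1 hi; have i0 : 0 <= iota.
  by rewrite -lee_fin; apply: le_trans hi; apply: esum_ge0.
have d0 : 0 < 1 - iota by rewrite subr_gt0.
have nilN N : (bridge s `&` len_le N) (pnil o) by split=> //; exact: bridge_nil.
have c1 : 1 <= (1 - iota)^-1 by rewrite invf_ge1 // gerBl.
elim=> [|N IHN]; rewrite psum_nonempty //.
  rewrite esum1 ?adde0 // => p [_ [[_ p0] p1]].
  by move: p1; rewrite /nonempty_path /=; move: p0; rewrite /len_le /= leqn0 => /eqP ->.
have h : (PSum o (bridge s `&` len_le N.+1 `&` nonempty_path) z l <=
    (1 - iota)^-1%:E * iota%:E)%E.
  apply: le_trans; last first.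
    apply: (@lee_wpmul2l _ (1 - iota)^-1%:E _ _ _ hi).
    by rewrite lee_fin invr_ge0 ltW.
  apply: le_trans; last apply: psum_prod_le IHN.
  - apply: (@psum_cut_le _ _ _ _ _ _ o _ _ (fun=> _) (first_cut s)) => // p [[bp pN] p0].
    have [/andP[f0 fp] ip br] := first_cut_split bp p0; split=> //; split=> //.
    by rewrite /len_le /= plen_drop; move: pN f0 fp; rewrite /len_le /=; lia.
  - by rewrite invr_ge0 ltW.
  - by apply: invariantI; [exact: invariant_bridge | exact: invariant_len_le].
apply: le_trans (leeD2l 1 h) _; rewrite -EFinM -EFinD lee_fin.
by rewrite le_eqVlt; apply/orP; left; apply/eqP; field; rewrite lt0r_neq0.
Qed.

End Renewal.
End Bridges.

#[global] Arguments nonempty_path {G}.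

(** * Hammersley-Welsh unfolding *)

Section HammersleyWelsh.
Context {R : realType} (G : mgraph) (Gam : set (gaut G)) {act : transitive_action Gam}.
Context (w : gpath G -> R) {wgood : good_weight Gam w}.

Let Glf : locally_finite G := action_locally_finite.

Local Notation height := (@height R G Gam).
Local Notation rise := (@rise R G Gam).
Local Notation bridge := (@bridge R G Gam).
Local Notation pweight := (pweight Gam w).
Local Notation PSum v A z l := (\esum_(p in from v A) (pweight z l p)%:E)%E.
Implicit Types (p q r : gpath G) (s t z l : R).

(** The last maximum is the one after which the function stays strictly lower,
as the lower end of a half-space walk requires. *)
Lemma exists_last_max (f : nat -> R) n : exists k, [/\ (k <= n)%N,
  (forall i, (i <= n)%N -> f i <= f k) & (forall i, (k < i <= n)%N -> f i < f k)].
Proof.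
elim: n => [|n [k [kn fle flt]]].
  exists 0%N; split=> // [i|i /andP[i0]]; first by rewrite leqn0 => /eqP ->.
  by rewrite leqn0 => /eqP i1; rewrite i1 in i0.
have [h|h] := leP (f k) (f n.+1).
  exists n.+1; split=> // [i|i /andP[ni] iN]; last by move: (leq_trans ni iN); rewrite ltnn.
  by rewrite leq_eqVlt => /orP[/eqP ->//|]; rewrite ltnS => /fle /le_trans; apply.
exists k; split=> [|i|i]; first exact: leqW.
  by rewrite leq_eqVlt => /orP[/eqP ->|]; [exact: ltW | rewrite ltnS; apply: fle].
move=> /andP[ki]; rewrite leq_eqVlt => /orP[/eqP ->//|]; rewrite ltnS => iN.
by apply: flt; rewrite ki iN.
Qed.

Definition last_max s p : nat :=
  projT1 (cid (exists_last_max (fun i => s * rise p i) (plen p))).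

Lemma last_maxP s p : [/\ (last_max s p <= plen p)%N,
  (forall i, (i <= plen p)%N -> s * rise p i <= s * rise p (last_max s p)) &
  (forall i, (last_max s p < i <= plen p)%N ->
     s * rise p i < s * rise p (last_max s p))].
Proof. by rewrite /last_max; case: cid. Qed.

Definition half_space s t : set (gpath G) := [set p |
  forall i, (0 < i <= plen p)%N -> 0 < s * rise p i < t].

Lemma invariant_half_space s t : invariant_paths Gam (half_space s t).
Proof.
by move=> f p Gf; rewrite /half_space /= pmap_len; split=> h i /h; rewrite !rise_map.
Qed.

Lemma half_space_nil s t v : half_space s t (pnil v).
Proof. by move=> i /= /andP[i0]; rewrite leqn0 => /eqP i1; rewrite i1 in i0. Qed.

Definition low_bridge s t : set (gpath G) :=
  [set p | bridge s p /\ s * rise p (plen p) < t].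

(** Cut at the last time of maximal height: what follows stays strictly below
that height and strictly above the starting point. *)
Lemma half_space_split s t p : half_space s t p -> (0 < plen p)%N ->
  [/\ (0 < last_max s p <= plen p)%N, low_bridge s t (ptake (last_max s p) p) &
    half_space (- s) (s * rise (ptake (last_max s p) p) (last_max s p))
      (pdrop (last_max s p) p)].
Proof.
move=> hp p0; have [kp kle klt] := last_maxP s p.
have k0 : (0 < last_max s p)%N.
  rewrite lt0n; apply/eqP => ke; have := kle 1%N p0; rewrite ke rise0 mulr0.
  by have /andP[] := hp 1%N ltac:(by rewrite p0); lra.
move: (last_max s p) k0 kp kle klt => k k0 kp kle klt.
rewrite rise_take ?leqnn ?kp //; split; first by rewrite k0.
  split; last by rewrite plen_take // rise_take ?leqnn ?kp //; have /andP[] := hp k ltac:(by rewrite k0).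
  move=> i; rewrite plen_take // => /andP[i0 ik].
  have ip := leq_trans ik kp.
  rewrite !rise_take ?leqnn ?ik ?kp // kle //.
  by have /andP[-> _] := hp i ltac:(by rewrite i0).
move=> i; rewrite plen_drop => /andP[i0 ik].
have kip : (k + i <= plen p)%N by rewrite -leq_subRL.
rewrite rise_drop //.
have /andP[h1 _] := hp (k + i)%N ltac:(by rewrite kip addn_gt0 k0).
have h2 := klt (k + i)%N ltac:(by rewrite kip -addn1 leq_add2l i0).
by apply/andP; split; rewrite mulrBr !mulNr; lra.
Qed.

Section Unfolding.
Variables (o : G) (z l : R).
Hypothesis z0 : 0 <= z.

Let W0 p : (0 <= (pweight z l p)%:E)%E. Proof. by rewrite lee_fin pweight_ge0. Qed.

(** Unfolding alternates between the two directions; collecting their bridges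
in one set lets the same quantity bound both. *)
Definition both_bridges N : set (gpath G) :=
  from o ((bridge 1 `|` bridge (-1)) `&` nonempty_path `&` len_le N).

Lemma finite_both_bridges N : finite_set (both_bridges N).
Proof.
by apply: sub_finite_set (finite_paths_le Glf o N) => p [sp [_ pN]].
Qed.

Definition span p : R := `|rise p (plen p)|.

Definition bridge_mass N t : R :=
  \sum_(q <- fset_set (both_bridges N) | span q < t) pweight z l q.

Lemma span_bridge s p : s ^+ 2 = 1 -> bridge s p -> s * rise p (plen p) = span p.
Proof.
move=> s1 bp; have s1n : `|s| = 1 by apply/eqP; rewrite -sqrp_eq1 // real_normK ?num_real // s1.
rewrite /span -[RHS]mul1r -s1n -normrM ger0_norm //.
have [p0|p0] := posnP (plen p); first by rewrite p0 rise0 mulr0.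
by rewrite ltW // bridge_end_gt0.
Qed.

Lemma psum_bridge_mass N s t (f : R -> R) : s ^+ 2 = 1 -> (forall u, 0 <= f u) ->
  (\esum_(q in from o (low_bridge s t `&` nonempty_path `&` len_le N))
      (pweight z l q * f (s * rise q (plen q)))%:E <=
   (\sum_(q <- fset_set (both_bridges N) | span q < t) pweight z l q * f (span q))%:E)%E.
Proof.
move=> s1 f0.
have g0 q : (0 <= (pweight z l q * f (span q))%:E)%E by rewrite lee_fin mulr_ge0 ?pweight_ge0.
apply: (@le_trans _ _ (\esum_(q in both_bridges N `&` [set q | (span q < t)%R])
    (pweight z l q * f (span q))%:E)%E).
  apply: (le_esum_inj (e := id)) => // [q|q [_ [[[bq _] _] _]]]; last first.
    by rewrite (span_bridge s1 bq).
  move=> [sq [[[bq qt] q0] qN]]; split; last by rewrite /= -(span_bridge s1 bq).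
  split=> //; split=> //; split=> //.
  have : (s - 1) * (s + 1) = 0 by rewrite -subr_sqr s1 expr1n subrr.
  move=> /eqP; rewrite mulf_eq0 => /orP[]/eqP hs; [left|right].
    by have <- : s = 1 by lra.
  by have <- : s = -1 by lra.
have fin := finite_both_bridges N.
rewrite esum_mkcondr esum_fset //; last first.
  by move=> q _; case: ifP.
rewrite fsbig_finite //= -big_mkcond /= sumEFin.
rewrite lee_fin le_eqVlt; apply/orP; left; apply/eqP; apply: eq_bigl => q.
by apply/idP/idP => [/set_mem|h]; last exact: mem_set.
Qed.

Lemma bridge_mass_mono N t : bridge_mass N t <= bridge_mass N.+1 t.
Proof.
have sub : {subset fset_set (both_bridges N) <= fset_set (both_bridges N.+1)}.
  move=> q; rewrite !in_fset_set ?inE; [|exact: finite_both_bridges..].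
  by move=> [sq [bq qN]]; split=> //; split=> //; apply: leqW.
rewrite /bridge_mass [leRHS](bigID (mem (fset_set (both_bridges N)))) /=.
rewrite ler_wpDr ?sumr_ge0 // => [q _|]; first exact: pweight_ge0.
rewrite [leRHS](eq_bigl (fun q => (q \in fset_set (both_bridges N)) && (span q < t))); last first.
  by move=> q; rewrite andbC.
rewrite le_eqVlt; apply/orP; left; apply/eqP.
rewrite -[RHS]big_filter_cond; apply: perm_big.
apply: uniq_perm; rewrite ?filter_uniq ?fset_uniq // => q.
by rewrite mem_filter; apply/idP/andP => [h|[]//]; split=> //; apply: sub.
Qed.

(** A half-space walk of span below [t] is a bridge of span below [t] followed
by a half-space walk in the opposite direction whose span is below that of the
bridge.  The resulting recursion is solved by [gronwall_sum], and it lowers the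
length because the bridge is not empty. *)
Lemma half_space_le N : forall s t v, s ^+ 2 = 1 ->
  (PSum v (half_space s t `&` len_le N) z l <= (expR (bridge_mass N t))%:E)%E.
Proof.
have base v s t N' : (PSum v (half_space s t `&` len_le N') z l =
    1 + PSum v (half_space s t `&` len_le N' `&` nonempty_path) z l)%E.
  by rewrite psum_nonempty //; split=> //; exact: half_space_nil.
have m0 N' t : 0 <= bridge_mass N' t.
  by apply: sumr_ge0 => q _; apply: pweight_ge0.
elim: N => [|N IHN] s t v s1; rewrite base.
  rewrite esum1 ?adde0 => [|p [_ [[_ p0] p1]]].
    by rewrite lee_fin; apply: le_trans (expR_ge1Dx _); rewrite lerDl.
  by move: p1; rewrite /nonempty_path /=; move: p0; rewrite /len_le /= leqn0 => /eqP ->.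
apply: (@le_trans _ _ (1 + (\sum_(q <- fset_set (both_bridges N.+1) | span q < t)
    pweight z l q * expR (bridge_mass N.+1 (span q)))%:E)%E); last first.
  rewrite -EFinD lee_fin; apply: gronwall_sum => q; exact: pweight_ge0.
apply: leeD2l.
have step := psum_bridge_mass N.+1 t s1 (fun u => expR_ge0 (bridge_mass N.+1 u)).
apply: le_trans step; rewrite (from_transport o v (act := act)); first last.
- move=> g q Gg; rewrite (pweight_invariant _ _ _ Gg).
  by rewrite pmap_len rise_map.
- apply: invariantI; last exact: invariant_len_le.
  apply: invariantI; last exact: invariant_nonempty.
  by move=> f p Gf; rewrite /low_bridge /= pmap_len rise_map //; split=> -[/(invariant_bridge s p Gf)].
apply: le_trans.
  apply: (@psum_cut_le _ _ _ _ _ _ v _ (low_bridge s t `&` nonempty_path `&` len_le N.+1)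
    (fun q => half_space (- s) (s * rise q (plen q)) `&` len_le N) (last_max s)) => //.
  move=> p [[hp pN] p0]; have [/andP[k0 kp] lb hs] := half_space_split hp p0.
  split=> //; last first.
    split; first by rewrite plen_take.
    by move: pN k0; rewrite /len_le /= plen_drop; lia.
  split; [split=> //|]; first by rewrite /nonempty_path /= plen_take.
  by rewrite /len_le /= plen_take //; apply: leq_trans kp pN.
apply: le_esum => q _; rewrite [leRHS]EFinM; apply: (@lee_wpmul2l _ (pweight z l q)%:E (W0 q)).
apply: le_trans (IHN _ _ _ _) _; first by rewrite sqrrN.
by rewrite lee_fin ler_expR; apply: bridge_mass_mono.
Qed.

End Unfolding.
End HammersleyWelsh.

(** * Strict growth away from the tilt 1/2 *)

(** On either side of 1/2, the tilt at distance |l - 1/2| from it is [l] or its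
mirror image [1 - l], and these two have the same growth rate. *)
Lemma reflected_tilt {R : realType} (l s : R) : s ^+ 2 = 1 ->
  2^-1 + s * `|l - 2^-1| = l \/ 2^-1 + s * `|l - 2^-1| = 1 - l.
Proof.
move=> s1; have : (s * `|l - 2^-1|) ^+ 2 = (l - 2^-1) ^+ 2.
  by rewrite exprMn s1 mul1r real_normK ?num_real.
by move=> /eqP; rewrite eqf_sqr => /orP[]/eqP ->; [left|right]; field.
Qed.

Section StrictGrowth.
Context {R : realType} (G : mgraph) (Gam : set (gaut G)) {act : transitive_action Gam}.
Context (w : gpath G -> R) {wgood : good_weight Gam w}.
Hypothesis nonuni : ~ unimodular R Gam.

Local Notation height := (@height R G Gam).
Local Notation edge_height := (@edge_height R G Gam).
Local Notation rise := (@rise R G Gam).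
Local Notation bridge := (@bridge R G Gam).
Local Notation irreducible_bridge := (@irreducible_bridge R G Gam).
Local Notation half_space := (@half_space R G Gam).
Local Notation last_max := (@last_max R G Gam).
Local Notation pweight := (pweight Gam w).
Local Notation PSum v A z l := (\esum_(p in from v A) (pweight z l p)%:E)%E.
Local Notation Z o l n := (Zw Gam o w l n).
Implicit Types (p q r : gpath G) (s t z l : R).

Lemma pweight_edge_gt0 z l (e : dart G) : 0 < z -> 0 < pweight z l (pedge e).
Proof.
move=> z0; rewrite /pweight !mulr_gt0 ?expR_gt0 ?exprn_gt0 //.
by apply: (lt_le_trans ltr01); apply: (weight_length1 wgood).
Qed.

Lemma bridge_mass_le o z l N t (b1 b2 : R) : 0 <= z ->
  (PSum o (bridge 1 `&` len_le N) z l <= b1%:E)%E ->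
  (PSum o (bridge (-1) `&` len_le N) z l <= b2%:E)%E ->
  bridge_mass Gam w o z l N t <= b1 + b2.
Proof.
move=> z0 h1 h2; have W0 p : (0 <= (pweight z l p)%:E)%E by rewrite lee_fin pweight_ge0.
have fin := @finite_both_bridges R G Gam act o N.
rewrite -lee_fin EFinD; apply: le_trans (leeD h1 h2).
apply: (@le_trans _ _ (\esum_(q in @both_bridges R G Gam o N) (pweight z l q)%:E)%E).
  rewrite (esum_fset fin) => [|q _]; last exact: W0.
  rewrite fsbig_finite //= sumEFin lee_fin /bridge_mass.
  rewrite big_mkcond; apply: ler_sum => q _; case: ifP => // _.
  exact: pweight_ge0.
rewrite (esumID (bridge 1)) //; apply: leeD; apply: le_esum_subset => // p.
  by move=> [[sp [_ pN]] b].
by move=> [[sp [[[b|b] _] pN]] nb].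
Qed.

Definition weak_max : set (gpath G) :=
  [set p | forall i, (i <= plen p)%N -> rise p i <= rise p (plen p)].

Definition weak_below : set (gpath G) :=
  [set p | forall i, (i <= plen p)%N -> rise p i <= 0].

Lemma invariant_weak_max : invariant_paths Gam weak_max.
Proof.
by move=> f p Gf; rewrite /weak_max /= pmap_len; split=> h i /h; rewrite !rise_map.
Qed.

Lemma invariant_weak_below : invariant_paths Gam weak_below.
Proof.
by move=> f p Gf; rewrite /weak_below /= pmap_len; split=> h i /h; rewrite !rise_map.
Qed.

Lemma weak_max_prev p : weak_max (prev p) <-> weak_below p.
Proof.
rewrite /weak_max /weak_below /= plen_prev; split=> h i ip.
  have := h (plen p - i)%N (leq_subr _ _).
  by rewrite !rise_prev ?leq_subr // subKn // subnn rise0; lra.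
have := h (plen p - i)%N (leq_subr _ _).
by rewrite !rise_prev // subnn rise0; lra.
Qed.

Lemma height_bound : exists2 L : R, 0 < L & forall p i N, (i <= plen p)%N ->
  (plen p <= N)%N -> `|rise p i| < L * N.+1%:R.
Proof.
have [L L0 hL] := @edge_height_bounded R G Gam act; exists L => // p i N ip pN.
apply: le_lt_trans (height_walk_le hL ip) _; rewrite ltr_pM2l // ltr_nat ltnS.
exact: leq_trans pN.
Qed.

(** Prepending a descending edge turns a walk that stays weakly below its
starting point into one that stays strictly below it, without loss of weight. *)
Lemma weak_below_le o z l N t (e : dart G) (M : R) : 0 < z -> src e = o ->
  edge_height e < 0 ->
  (forall p i, (i <= plen p)%N -> (plen p <= N.+1)%N -> `|rise p i| < t) ->
  (PSum o (half_space (-1) t `&` len_le N.+1) z l <= M%:E)%E ->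
  (PSum o (weak_below `&` len_le N) z l <= (M / pweight z l (pedge e))%:E)%E.
Proof.
move=> z0 se he ht hM; have W0 p : (0 <= (pweight z l p)%:E)%E.
  by rewrite lee_fin pweight_ge0 // ltW.
have e0 := pweight_edge_gt0 l e z0.
have inv : invariant_paths Gam (weak_below `&` len_le N).
  by apply: invariantI; [exact: invariant_weak_below | exact: invariant_len_le].
rewrite mulrC EFinM -[leLHS]mul1e -(@mulVf _ (pweight z l (pedge e))) ?gt_eqF //.
rewrite EFinM -muleA; apply: lee_wpmul2l; first by rewrite lee_fin invr_ge0 ltW.
apply: le_trans hM; rewrite (psum_transport o (tgt e) z l inv).
have -> : ((pweight z l (pedge e))%:E * PSum (tgt e) (weak_below `&` len_le N) z l =
    \esum_(q in from o [set pedge e]) ((pweight z l q)%:E *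
       PSum (pend q) (weak_below `&` len_le N) z l))%E.
  rewrite (_ : from o _ = [set pedge e]) ?esum_set1 //; last first.
    by apply/seteqP; split=> [q []//|q ->].
  by rewrite mule_ge0 // esum_ge0.
apply: (@psum_join_ge _ _ _ _ _ _ o _ _ (fun=> weak_below `&` len_le N) (fun=> 1%N)).
  exact: ltW.
move=> q r c qe [br rN]; rewrite qe in c *; have re : rise (pedge e) 1 = edge_height e by [].
have lj : plen (pjoin (pedge e) r) = (plen r).+1 by rewrite (plen_join c).
have hr j : (j <= plen r)%N -> rise (pjoin (pedge e) r) j.+1 < 0.
  move=> jr; rewrite -[j.+1]/(plen (pedge e) + j)%N rise_joinr //.
  by have := br j jr; rewrite re; lra.
split=> //.
  split; last by rewrite /len_le /= lj.
  move=> i; rewrite lj; case: i => // i /= ir.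
  have h1 := hr i ir; rewrite mulN1r oppr_gt0 h1 /=.
  have := ht (pjoin (pedge e) r) i.+1; rewrite lj => /(_ ir rN).
  by rewrite ltr0_norm.
move=> [|i] // j _ /andP[j0 jr] ij.
have := hr j jr.
have -> : rise (pjoin (pedge e) r) j.+1 = height (src e) (pvertex r j).
  rewrite -(pvertex_joinr c jr) -[src e]/(pstart (pedge e)).
  by rewrite -(pstart_join (pedge e) r).
by rewrite -ij pvertex0 height_refl ltxx.
Qed.

(** Cut a walk at its last maximum.  The second piece is a half-space walk.  The
first, once reversed, stays weakly below its starting point; reversal preserves
the tilt 1/2. *)
Lemma psum_all_le o z (b : R) : 0 < z ->
  (forall N t, bridge_mass Gam w o z 2^-1 N t <= b) ->
  exists M : R, forall N, (PSum o (len_le N) z 2^-1 <= M%:E)%E.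
Proof.
move=> z0 hb; have z0' := ltW z0.
have [d d0 hd] := climbing_edge nonuni.
have [e se he] := hd (-1) ltac:(by rewrite sqrrN expr1n) o.
have [L L0 hL] := height_bound.
exists (expR b * (expR b / pweight z 2^-1 (pedge e))) => N.
(* No path of length at most N' reaches the height L (N' + 1). *)
have half N' : (PSum o (half_space (-1) (L * N'.+1%:R) `&` len_le N') z 2^-1 <=
    (expR b)%:E)%E.
  apply: le_trans (half_space_le o 2^-1 z0' N' _ o _) _; first by rewrite sqrrN expr1n.
  by rewrite lee_fin ler_expR.
have weak : (PSum o (weak_max `&` len_le N) z 2^-1 <=
    (expR b / pweight z 2^-1 (pedge e))%:E)%E.
  rewrite psum_reverse //; last first.
    by apply: invariantI; [exact: invariant_weak_max | exact: invariant_len_le].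
  rewrite (_ : 1 - 2^-1 = 2^-1 :> R); last by field.
  rewrite (_ : (fun p => _) = weak_below `&` len_le N); last first.
    apply/seteqP; split=> p [/weak_max_prev h1 h2]; split=> //.
      by move: h2; rewrite /len_le /= plen_prev.
    by rewrite /len_le /= plen_prev.
  apply: (weak_below_le z0 se _ _ (half N.+1)); first by lra.
  by move=> p i ip pN; apply: hL.
apply: (@le_trans _ _ (\esum_(q in from o (weak_max `&` len_le N))
   ((pweight z 2^-1 q)%:E * PSum (pend q) (half_space (-1) (L * N.+1%:R) `&` len_le N) z 2^-1))%E).
  apply: (@psum_cut_le _ _ _ _ _ _ o _ _ (fun=> _) (last_max 1)) => // p pN.
  have [kp kle klt] := @last_maxP R G Gam 1 p; have pN' : (plen p <= N)%N := pN.
  split=> //.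
    split; last by rewrite /len_le /= plen_take // (leq_trans kp).
    move=> i; rewrite plen_take // => ik; rewrite !rise_take ?leqnn ?kp ?ik //.
    by have := kle i (leq_trans ik kp); rewrite !mul1r.
  split; last by rewrite /len_le /= plen_drop (leq_trans (leq_subr _ _)).
  move=> i; rewrite plen_drop => /andP[i0 ik].
  have kip : (last_max 1 p + i <= plen p)%N by rewrite -leq_subRL.
  have := klt (last_max 1 p + i)%N ltac:(by rewrite kip -addn1 leq_add2l i0).
  have := hL (pdrop (last_max 1 p) p) i N; rewrite plen_drop ik rise_drop // !mul1r.
  move=> /(_ isT (leq_trans (leq_subr _ _) pN')) h1 h2; rewrite mulN1r.
  by move: h1; rewrite oppr_gt0 subr_lt0 h2 ltr0_norm ?subr_lt0.
apply: le_trans (psum_prod_le z0' _ (expR_ge0 _) _ (half N)) _.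
  by apply: invariantI; [exact: invariant_half_space | exact: invariant_len_le].
by rewrite EFinM lee_wpmul2l // lee_fin expR_ge0.
Qed.

(** Monotone convergence: a finite part of the sum has bounded length, so that
scaling [z] by [th] costs at most a fixed power of [th]. *)
Lemma psum_le1_left A o zt l : 0 < zt ->
  (forall z, 0 <= z -> z < zt -> (PSum o A z l <= 1)%E) ->
  (PSum o A zt l <= 1)%E.
Proof.
move=> zt0 h; have W0 z p : 0 <= z -> (0 <= (pweight z l p)%:E)%E.
  by move=> ?; rewrite lee_fin pweight_ge0.
apply: esum_le_bound => [F finF FA|p _]; last exact/W0/ltW.
have [N hN] : exists N, forall p, F p -> (plen p <= N)%N.
  exists (\max_(p <- fset_set F) plen p)%N => p Fp.
  by apply: (@leq_bigmax_seq _ _ xpredT (@plen G)) => //; rewrite in_fset_set // inE.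
have FE z : 0 <= z -> (\esum_(p in F) (pweight z l p)%:E =
    (\sum_(p <- fset_set F) pweight z l p)%:E)%E.
  move=> z0; rewrite esum_fset // => [|p _]; last exact: W0.
  by rewrite fsbig_finite //= sumEFin.
rewrite FE ?(ltW zt0) // lee_fin; apply: (@le_of_shrinking _ _ N) => th th0 th1.
have z0 : 0 <= th * zt by rewrite mulr_ge0 // ltW.
have zlt : th * zt < zt by rewrite gtr_pMl.
rewrite -lee_fin; apply: le_trans (h _ z0 zlt).
apply: (@le_trans _ _ (\esum_(p in F) (pweight (th * zt) l p)%:E)%E); last first.
  by apply: le_esum_subset => // p _; apply: W0.
rewrite FE // lee_fin mulr_suml big_seq [leRHS]big_seq; apply: ler_sum => p.
rewrite in_fset_set // inE => /hN pN.
rewrite /pweight exprMn mulrCA [leRHS](_ : _ = th ^+ plen p *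
  (w p * zt ^+ plen p * expR (l * height (pstart p) (pend p)))); last by ring.
rewrite mulrC ler_wpM2r ?pweight_ge0 ?(ltW zt0) // ler_wiXn2l ?(ltW th0) ?(ltW th1) //.
Qed.

(** Since the tilt [l] favours the direction [s], passing to the tilt 1/2 lowers
the weight of every bridge, and strictly that of a single climbing edge. *)
Lemma irreducible_lt1 o zt s l : 0 < zt -> s ^+ 2 = 1 -> 0 < s * (l - 2^-1) ->
  (PSum o (irreducible_bridge s) zt l <= 1)%E ->
  exists2 iota : R, iota < 1 & (PSum o (irreducible_bridge s) zt 2^-1 <= iota%:E)%E.
Proof.
move=> zt0 s1 sl h; have W0 l' p : (0 <= (pweight zt l' p)%:E)%E.
  by rewrite lee_fin pweight_ge0 // ltW.
have [d d0 hd] := climbing_edge nonuni; have [e se he] := hd s s1 o.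
have le_w p : 0 <= s * rise p (plen p) -> pweight zt 2^-1 p <= pweight zt l p.
  move=> sp; rewrite /pweight ler_wpM2l ?mulr_ge0 ?exprn_ge0 ?(ltW zt0) //.
    exact: (weight_ge0 wgood).
  rewrite ler_expR height_rise -subr_ge0 -mulrBl.
  have -> : (l - 2^-1) * rise p (plen p) = (s * (l - 2^-1)) * (s * rise p (plen p)).
    by rewrite mulrACA -expr2 s1 mul1r.
  by rewrite mulr_ge0 // ltW.
pose del := pweight zt l (pedge e) - pweight zt 2^-1 (pedge e).
have del0 : 0 < del.
  rewrite subr_gt0 /pweight ltr_pM2l; last first.
    rewrite mulr_gt0 ?exprn_gt0 //; apply: (lt_le_trans ltr01).
    exact: (weight_length1 wgood).
  rewrite ltr_expR -subr_gt0 -mulrBl -[height _ _]/(edge_height e).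
  have -> : (l - 2^-1) * edge_height e = (s * (l - 2^-1)) * (s * edge_height e).
    by rewrite mulrACA -expr2 s1 mul1r.
  by rewrite mulr_gt0 // he.
have irr_e : from o (irreducible_bridge s) (pedge e).
  split=> //; split=> //.
    have re : rise (pedge e) 1 = edge_height e by [].
    have pe : plen (pedge e) = 1%N by [].
    by case=> [|[|i]] // _; rewrite pe re he d0 lexx.
  by case=> // _ [].
exists (1 - del); first by rewrite ltrBlDr ltrDl.
pose ind p : \bar R := if p == pedge e then del%:E else 0%E.
have ind0 p : (0 <= ind p)%E by rewrite /ind; case: eqP => // _; rewrite lee_fin ltW.
suff : (PSum o (irreducible_bridge s) zt 2^-1 + del%:E <= 1)%E.
  by rewrite -leeBrDr // EFinB.
apply: le_trans h; apply: (@le_trans _ _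
  (PSum o (irreducible_bridge s) zt 2^-1 + \esum_(p in from o (irreducible_bridge s)) ind p)%E).
  apply: leeD2l; rewrite -[leLHS](_ : \esum_(p in [set pedge e]) ind p = del%:E)%E.
    by apply: le_esum_subset => // p ->.
  by rewrite esum_set1 // /ind eqxx.
rewrite -esumD //; apply: le_esum => p [_ [bp p0 _]]; rewrite /ind.
have [->|_] := eqVneq p (pedge e); first by rewrite -EFinD lee_fin /del addrC subrK.
by rewrite adde0 lee_fin le_w // ltW // bridge_end_gt0.
Qed.

(** The bridges of direction [s] are summable at any [zt] up to the critical
point of some tilt that favours [s], included. *)
Lemma bridges_bounded o zt s l : 0 < zt -> s ^+ 2 = 1 -> 0 < s * (l - 2^-1) ->
  zt <= z_c Gam o w l ->
  exists b : R, forall N, (PSum o (bridge s `&` len_le N) zt 2^-1 <= b%:E)%E.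
Proof.
move=> zt0 s1 sl ztl.
have i1 : (PSum o (irreducible_bridge s) zt l <= 1)%E.
  apply: (psum_le1_left zt0) => z z0 zlt.
  have [M hM] := chi_subcritical nonuni z0 (lt_le_trans zlt ztl).
  by apply: (irreducible_le1 s z0 (M := M)); rewrite -chi_psum.
have [iota io hi] := irreducible_lt1 zt0 s1 sl i1.
by exists (1 - iota)^-1 => N; apply: (bridge_le_geometric (ltW zt0) io hi).
Qed.

(** Otherwise the bridges of both directions would be summable at
z_t with tilt 1/2, and so would be all walks, whereas z_t^n Z(1/2; n) >= 1. *)
Lemma mu_c_strict o l : l <> 2^-1 -> mu_c Gam o w 2^-1 < mu_c Gam o w l.
Proof.
move=> /eqP l2; rewrite ltNge; apply/negP => mle.
have m2 : 0 < mu_c Gam o w 2^-1 by exact: mu_c_gt0.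
have ml : 0 < mu_c Gam o w l by exact: mu_c_gt0.
have [zt zt0 [ztm ztl]] : exists2 zt : R, 0 < zt &
    zt * mu_c Gam o w 2^-1 = 1 /\ zt <= z_c Gam o w l.
  rewrite /z_c; move: (mu_c Gam o w l) (mu_c Gam o w 2^-1) mle m2 ml => m m' mle m2 ml.
  exists m'^-1; first by rewrite invr_gt0.
  by split; [rewrite mulVf // gt_eqF | rewrite lef_pV2].
have irr s : s ^+ 2 = 1 ->
    exists b : R, forall N, (PSum o (bridge s `&` len_le N) zt 2^-1 <= b%:E)%E.
  move=> s1; apply: (bridges_bounded (l := 2^-1 + s * `|l - 2^-1|) zt0 s1).
    by rewrite addrAC subrr add0r mulrA -expr2 s1 mul1r normr_gt0 subr_eq0.
  by rewrite /z_c; have [->|->] := reflected_tilt l s1; rewrite ?mu_c_reverse.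
have [b1 hb1] := irr 1 (expr1n _ _).
have [b2 hb2] := irr (-1) ltac:(by rewrite sqrrN expr1n).
have [M hM] := psum_all_le zt0 (fun N t => bridge_mass_le t (ltW zt0) (hb1 N) (hb2 N)).
have big N : N.+1%:R <= M.
  have := hM N; rewrite psum_len_le ?(ltW zt0) // lee_fin; apply: le_trans.
  rewrite -[N.+1 in leLHS]card_ord -sumr_const; apply: ler_sum => i _.
  apply: (@le_trans _ _ (zt ^+ i * mu_c Gam o w 2^-1 ^+ i)).
    by rewrite -exprMn ztm expr1n.
  rewrite ler_wpM2l ?exprn_ge0 ?(ltW zt0) //; exact: mu_c_le.
have := big (Num.truncn `|M|); rewrite leNgt => /negP; apply.
by apply: le_lt_trans (ler_norm _) _; rewrite truncnS_gt.
Qed.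

End StrictGrowth.

(** * The bubble and the susceptibility *)

Section Bubble.
Context {R : realType} (G : mgraph) (Gam : set (gaut G)) {act : transitive_action Gam}.
Context (w : gpath G -> R) {wgood : good_weight Gam w}.
Hypothesis nonuni : ~ unimodular R Gam.

Local Notation height := (@height R G Gam).
Local Notation pweight := (pweight Gam w).
Local Notation PSum v A z l := (\esum_(p in from v A) (pweight z l p)%:E)%E.
Local Notation Z o l n := (Zw Gam o w l n).
Implicit Types (p q r : gpath G).

Definition first_meeting_spec p q (k : nat * nat) : Prop :=
  [/\ (k.1 <= plen p)%N, (k.2 <= plen q)%N, pvertex p k.1 = pvertex q k.2 &
    forall i j, (i < k.1)%N -> (j <= plen q)%N -> pvertex p i <> pvertex q j].

Lemma exists_first_meeting p q : pend p = pstart q ->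
  exists k, first_meeting_spec p q k.
Proof.
move=> e; pose P i := `[< (i <= plen p)%N /\
  exists2 j, (j <= plen q)%N & pvertex p i = pvertex q j >].
have exP : exists i, P i.
  exists (plen p); apply/asboolP; split=> //; exists 0%N => //.
  by rewrite pvertex_plen e.
case: (ex_minnP exP) => i /asboolP[ip [j jq ij]] mini; exists (i, j); split=> //= i' j' i'i j'q e'.
have : (i <= i')%N; last by rewrite leqNgt i'i.
apply: mini; apply/asboolP; split; first exact: leq_trans (ltnW i'i) ip.
by exists j'.
Qed.

Definition first_meeting p q : nat * nat := xget (0%N, 0%N) (first_meeting_spec p q).

Lemma first_meetingP p q : pend p = pstart q ->
  first_meeting_spec p q (first_meeting p q).
Proof. by move=> e; have [k hk] := exists_first_meeting e; apply: xgetPex; exists k. Qed.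

Definition loop_pairs (x : G) : set (gpath G * gpath G) :=
  [set k | [/\ pstart k.1 = x, pstart k.2 = pend k.1 & pend k.2 = x]].

(** The height differences of the two halves of a loop are opposite. *)
Lemma loop_pairs_tilt z l l' x k : loop_pairs x k ->
  pweight z l k.1 * pweight z l k.2 = pweight z l' k.1 * pweight z l' k.2.
Proof.
case: k => p q [/= sp sq eq].
have h l0 : pweight z l0 p * pweight z l0 q = w p * w q * (z ^+ plen p * z ^+ plen q).
  rewrite /pweight sq eq sp (heightC x (pend p)) mulrN expRN.
  rewrite mulrACA divff ?gt_eqF ?expR_gt0 // mulr1; ring.
by rewrite !h.
Qed.

(** At the tilt 1/2, loops are some of the contiguous pairs of walks, which
factor. *)
Lemma loop_pairs_le o x z (M : R) : 0 <= z -> 0 <= M ->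
  (PSum o setT z 2^-1 <= M%:E)%E ->
  (\esum_(k in loop_pairs x) (pweight z 2^-1 k.1 * pweight z 2^-1 k.2)%:E <= (M ^+ 2)%:E)%E.
Proof.
move=> z0 M0 hM; apply: (@le_trans _ _ (\esum_(k in from x setT `*`` (fun q => from (pend q) setT))
    (pweight z 2^-1 k.1 * pweight z 2^-1 k.2)%:E)%E).
  apply: le_esum_subset => [[p q] [/= sp sq eq]|k _]; last first.
    by rewrite lee_fin mulr_ge0 ?pweight_ge0.
  by split; split.
have hx : (PSum x setT z 2^-1 <= M%:E)%E by rewrite (psum_transport x o).
rewrite -psum_pairs //; apply: le_trans (psum_prod_le z0 _ M0 _ hx) _ => //.
by rewrite expr2 EFinM lee_wpmul2l ?lee_fin.
Qed.

(** Splitting a pair of contiguous walks at the first vertex of the first walk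
that the second one visits leaves two disjoint outer pieces and two inner pieces
that form a loop.  The disjoint pieces are encoded as one walk of length at most
2 N with a marked time, whence the factor 2 N + 1. *)
Lemma square_le_bubble o z l N (M : R) : 0 <= z -> 0 <= M ->
  (PSum o setT z 2^-1 <= M%:E)%E ->
  (\sum_(n < N.+1) z ^+ n * Z o l n) ^+ 2 <=
  M ^+ 2 * (2 * N + 1)%:R * \sum_(n < (2 * N).+1) z ^+ n * Z o l n.
Proof.
move=> z0 M0 hM; have W0 l' p : 0 <= pweight z l' p by apply: pweight_ge0.
pose S N' := \sum_(n < N'.+1) z ^+ n * Z o l n.
have SE N' : PSum o (len_le N') z l = (S N')%:E by apply: psum_len_le.
have S0 N' : 0 <= S N'.
  by apply: sumr_ge0 => n _; rewrite mulr_ge0 ?exprn_ge0 ?Zw_ge0.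
rewrite -/(S N) -/(S (2 * N)%N) -lee_fin.
have -> : ((S N ^+ 2)%:E = \esum_(k in from o (len_le N) `*`` (fun q => from (pend q) (len_le N)))
    (pweight z l k.1 * pweight z l k.2)%:E)%E.
  rewrite -psum_pairs // (psum_prod _ z0 (S0 N) _ (SE N)) ?SE ?expr2 //.
  exact: invariant_len_le.
pose I : set (gpath G * nat) := from o (len_le (2 * N)) `*` `I_(2 * N + 1).
pose J (k : gpath G * nat) := loop_pairs (pvertex k.1 k.2).
pose F (k : gpath G * nat) (c : gpath G * gpath G) : \bar R :=
  (pweight z l k.1 * (pweight z 2^-1 c.1 * pweight z 2^-1 c.2))%:E.
have F0 k c : (0 <= F k c)%E by rewrite /F lee_fin mulr_ge0 ?W0 // mulr_ge0 ?W0.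
(* [glue] is a left inverse of [cut]. *)
pose cut (k : gpath G * gpath G) :=
  let ij := first_meeting k.1 k.2 in
  ((pjoin (ptake ij.1 k.1) (pdrop ij.2 k.2), ij.1),
   (pdrop ij.1 k.1, ptake ij.2 k.2)).
pose glue (k : (gpath G * nat) * (gpath G * gpath G)) :=
  (pjoin (ptake k.1.2 k.1.1) k.2.1, pjoin k.2.2 (pdrop k.1.2 k.1.1)).
apply: (@le_trans _ _ (\esum_(k in I `*`` J) F k.1 k.2)%E).
  apply: (le_esum_inj (e := cut)) => //.
  - move=> [p q] [/= [sp pN] [/esym e qN]].
    have [/=] := first_meetingP e; rewrite /cut /=.
    case: (first_meeting p q) => i j /= ip jq ij _.
    have c : pend (ptake i p) = pstart (pdrop j q) by rewrite pend_take // pstart_drop.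
    have pN' : (plen p <= N)%N := pN; have qN' : (plen q <= N)%N := qN.
    split; [split; [split|]|] => /=.
    + by rewrite pstart_join.
    + by rewrite /len_le /= plen_join // plen_take // plen_drop; lia.
    + by lia.
    + have vi : pvertex (pjoin (ptake i p) (pdrop j q)) i = pvertex p i.
        by rewrite pvertex_joinl ?plen_take // pvertex_take // leqnn.
      split=> /=; first by rewrite vi pstart_drop.
        by rewrite pend_drop pstart_take.
      by rewrite vi pend_take.
  - have cutK k : (from o (len_le N) `*`` (fun q => from (pend q) (len_le N))) k ->
        glue (cut k) = k.
      case: k => p q [/= [sp pN] [/esym e qN]].
      have [/=] := first_meetingP e; rewrite /cut /glue /=.
      case: (first_meeting p q) => i j /= ip jq ij _.
      have c : pend (ptake i p) = pstart (pdrop j q) by rewrite pend_take // pstart_drop.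
      have li : plen (ptake i p) = i by rewrite plen_take.
      rewrite -{1 4}li ptake_join // pdrop_join //.
      by rewrite !pjoin_take_drop.
    by move=> k k' /set_mem hk /set_mem hk' e; rewrite -(cutK _ hk) -(cutK _ hk') e.
  - move=> [p q] [/= [sp pN] [/esym e qN]].
    have [/=] := first_meetingP e; rewrite /F /cut /=.
    case: (first_meeting p q) => i j /= ip jq ij disj.
    have c : pend (ptake i p) = pstart (pdrop j q) by rewrite pend_take // pstart_drop.
    have lp : loop_pairs (pvertex p i) (pdrop i p, ptake j q).
      split=> /=; first by rewrite pstart_drop.
        by rewrite pend_drop pstart_take.
      by rewrite pend_take.
    have := loop_pairs_tilt z l 2^-1 lp => /= <-.
    rewrite lee_fin pweight_join //; last first.
      move=> a b; rewrite plen_take // plen_drop => ai /andP[b0 bj].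
      have jb : (j + b <= plen q)%N by rewrite -leq_subRL.
      rewrite pvertex_take ?(ltnW ai) // pvertex_drop //.
      by apply: disj.
    have split_le k r : pweight z l r <= pweight z l (ptake k r) * pweight z l (pdrop k r).
      by rewrite -{1}(pjoin_take_drop k r); apply: pweight_join_le.
    apply: le_trans (ler_pM (W0 _ _) (W0 _ _) (split_le i p) (split_le j q)) _.
    rewrite le_eqVlt; apply/orP; left; apply/eqP.
    move: (pweight z l (ptake i p)) (pweight z l (pdrop i p)) (pweight z l (ptake j q))
      (pweight z l (pdrop j q)) => x1 x2 x3 x4.
    by ring.
rewrite -(esum_esum (a := F)) //.
apply: (@le_trans _ _ (\esum_(k in I) ((M ^+ 2)%:E * (pweight z l k.1)%:E))%E).
  apply: le_esum => k _; rewrite /F.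
  under eq_esum do rewrite EFinM.
  rewrite esumZl // => [|c _]; last by rewrite lee_fin mulr_ge0.
  rewrite muleC; apply: lee_wpmul2r; first by rewrite lee_fin.
  exact: (loop_pairs_le (o := o) _ z0 M0 hM).
rewrite esumZl ?exprn_ge0 // => [|k _]; last by rewrite lee_fin.
rewrite -mulrA [leRHS]EFinM; apply: lee_wpmul2l; first by rewrite lee_fin exprn_ge0.
rewrite (_ : I = from o (len_le (2 * N)) `*`` (fun=> `I_(2 * N + 1))) //.
rewrite -(esum_esum (a := fun p (_ : nat) => (pweight z l p)%:E)) => [|p i _ _]; last first.
  by rewrite lee_fin.
rewrite EFinM -SE -esumZl // => [|p _]; last by rewrite lee_fin.
apply: le_esum => p _; rewrite esum_const ?lee_fin //.
by rewrite /rcard (@card_fset_set _ _ (2 * N + 1)%N) // card_eq_refl.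
Qed.

(** The doubling inequality is used at z_(c,l), where the susceptibility of tilt
1/2 is finite because z_(c,l) < z_t. *)
Lemma Zw_le_mu o l : l <> 2^-1 ->
  exists2 C : R, 0 < C & forall n, Z o l n <= C * mu_c Gam o w l ^+ n.
Proof.
move=> l2; have ms : mu_c Gam o w 2^-1 < mu_c Gam o w l by exact: mu_c_strict.
have m2 : 0 < mu_c Gam o w 2^-1 by exact: mu_c_gt0.
have ml : 0 < mu_c Gam o w l by exact: mu_c_gt0.
have [zc zc0 [zmu zct]] : exists2 zc : R, 0 < zc &
    zc * mu_c Gam o w l = 1 /\ zc < z_c Gam o w 2^-1.
  rewrite /z_c; move: (mu_c Gam o w l) (mu_c Gam o w 2^-1) ms m2 ml => m m' ms m2 ml.
  exists m^-1; first by rewrite invr_gt0.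
  by split; [rewrite mulVf // gt_eqF | rewrite ltf_pV2].
have [M0 hM0] := chi_subcritical nonuni (ltW zc0) zct.
pose M := `|M0| + 1.
have Mp : 0 < M by rewrite /M ltr_wpDl.
have hM : (PSum o setT zc 2^-1 <= M%:E)%E.
  rewrite -chi_psum ?(ltW zc0) //; apply: le_trans hM0 _; rewrite lee_fin /M.
  by rewrite ler_wpDr // ler_norm.
have [C C0 hC] : exists2 C, 0 < C & forall n, zc ^+ n * Z o l n <= C.
  apply: (@bounded_of_doubling _ (fun n => zc ^+ n * Z o l n) (M ^+ 2)).
  - by rewrite expr0 mul1r Zw0.
  - by move=> n; rewrite mulr_ge0 ?exprn_ge0 ?Zw_ge0 // ltW.
  - move=> m n; rewrite exprD mulrACA ler_wpM2l ?mulr_ge0 ?exprn_ge0 ?(ltW zc0) //.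
    exact: Zw_submul.
  - move=> rho rho1; have mr : mu_c Gam o w l < mu_c Gam o w l * rho by rewrite ltr_pMr.
    have [C C0 hC] := Zw_le_geometric nonuni mr.
    exists C => // n; have := hC n.
    rewrite -(@ler_pM2l _ (zc ^+ n)) ?exprn_gt0 // => /le_trans; apply.
    by rewrite exprMn mulrCA [zc ^+ n * _]mulrA -exprMn zmu expr1n mul1r.
  - by rewrite exprn_gt0.
  - move=> N; apply: square_le_bubble => //; exact: ltW.
exists C => // n; apply: (@le_trans _ _ (zc ^+ n * Z o l n * mu_c Gam o w l ^+ n)).
  by rewrite mulrAC -exprMn zmu expr1n mul1r.
by apply: ler_wpM2r (hC n); apply: exprn_ge0; apply: ltW; exact: ml.
Qed.

End Bubble.

(** * Decay, ballisticity and the theorem *)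

Section Conclusions.
Context {R : realType}.

Lemma expR_ge1 (x : R) : (1 <= expR x) = (0 <= x).
Proof. by rewrite leNgt expR_lt1 -leNgt. Qed.

Lemma geometric_eseries (q : R) : 0 <= q -> q < 1 ->
  (\sum_(0 <= n <oo) (q ^+ n)%:E = ((1 - q)^-1)%:E)%E.
Proof.
move=> q0 q1; have qn : `|q| < 1 by rewrite ger0_norm.
have := @cvg_geometric_series R 1 q qn; rewrite mul1r => h.
apply: cvg_lim => //; rewrite (_ : (fun n => _) = EFin \o series (geometric 1 q)).
  exact: (cvg_comp _ _ h).
apply/funext => n; rewrite /series /= -sumEFin; apply: eq_bigr => i _.
by rewrite mul1r.
Qed.

Lemma eseries_between (a : nat -> R) (m C z : R) : 0 < m -> 0 < C ->
  (forall n, m ^+ n <= a n) -> (forall n, a n <= C * m ^+ n) ->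
  0 < z -> z < m^-1 ->
  ((m^-1 / (m^-1 - z))%:E <= \sum_(0 <= n <oo) (z ^+ n * a n)%:E)%E /\
  (\sum_(0 <= n <oo) (z ^+ n * a n)%:E <= (C * m^-1 / (m^-1 - z))%:E)%E.
Proof.
move=> m0 C0 lo hi z0 zm; have zm1 : z * m < 1 by rewrite -ltr_pdivlMr // div1r.
have zm0 : 0 <= z * m by rewrite ltW // mulr_gt0.
have e : m^-1 / (m^-1 - z) = (1 - z * m)^-1.
  by field; rewrite !gt_eqF //= subr_gt0 // mulrC.
have z0' n : 0 <= z ^+ n by rewrite exprn_ge0 // ltW.
rewrite -mulrA e EFinM -geometric_eseries //; split.
  apply: lee_nneseries => [n _ _|n _]; first by rewrite lee_fin exprn_ge0.
  by rewrite lee_fin exprMn ler_wpM2l.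
rewrite -nneseriesZl //; last by move=> n _; rewrite lee_fin exprn_ge0.
apply: lee_nneseries => [n _ _|n _].
  by rewrite lee_fin mulr_ge0 // (le_trans _ (lo n)) // exprn_ge0 // ltW.
by rewrite -EFinM lee_fin exprMn mulrCA ler_wpM2l.
Qed.

Lemma positive_lower_bound (del : nat -> R) N : (forall n, 0 < del n) ->
  exists2 e, 0 < e & forall n, (n < N)%N -> e <= del n.
Proof.
move=> d0; elim: N => [|N [e e0 he]]; first by exists 1.
exists (Num.min e (del N)); first by rewrite lt_min e0 d0.
move=> n; rewrite ltnS leq_eqVlt => /orP[/eqP ->|/he]; first by rewrite ge_min lexx orbT.
by rewrite ge_min => ->.
Qed.

(** Eventually the geometric factor absorbs [K] and the tilt; at the finitely
many remaining times a small enough [c] makes the positive lower bounds [del]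
suffice. *)
Lemma exists_rate (K th d eps : R) (del : nat -> R) :
  0 < th -> th < 1 -> 0 < d -> 0 <= eps -> (forall n, 0 < del n) ->
  exists2 c, 0 < c & c <= d /\ forall n,
    1 - expR (- c * n%:R) <= del n \/
    K * (expR (eps * (c * n%:R)) * th ^+ n) <= expR (- c * n%:R).
Proof.
move=> th0 th1 d0 eps0 del0.
(* Half of the rate - ln th absorbs [K], the other half the tilt and the
   target rate. *)
pose a := - ln th / 2.
have a0 : 0 < a by rewrite /a divr_gt0 // oppr_gt0 ln_lt0 // th0.
have thE n : th ^+ n = expR (- (2 * a) * n%:R).
  have -> : - (2 * a) = ln th by rewrite /a; field.
  by rewrite mulrC expRM_natl lnK // posrE.
have ea : 1 < expR a by rewrite expR_gt1.
have [N0 hN0] := exp_unbounded K ea.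
have [e e0 he] := positive_lower_bound N0 del0.
have eps1 : 0 < eps + 1 by rewrite ltr_wpDl.
pose c := Num.min d (Num.min (a / (eps + 1)) (e / N0.+1%:R)).
have c0 : 0 < c by rewrite /c !lt_min d0 (divr_gt0 a0 eps1) divr_gt0.
have cd : c <= d by rewrite /c ge_min lexx.
have ca : c * (eps + 1) <= a.
  by rewrite -ler_pdivlMr // /c !ge_min lexx orbT.
have ce : c * N0.+1%:R <= e.
  by rewrite -ler_pdivlMr // /c !ge_min lexx !orbT.
clearbody c; exists c => //; split=> // n; have [nN|Nn] := ltnP n N0.
  left; apply: le_trans (he n nN); apply: le_trans ce.
  apply: (@le_trans _ _ (c * n%:R)).
    have := expR_ge1Dx (- c * n%:R); rewrite mulNr; lra.
  by rewrite ler_wpM2l ?(ltW c0) // ler_nat ltnW // ltnS ltnW.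
right; have hK := ltW (hN0 n Nn); rewrite -expRM_natl in hK.
apply: (@le_trans _ _ (expR (n%:R * a) * (expR (eps * (c * n%:R)) * th ^+ n))).
  by apply: ler_wpM2r hK; rewrite mulr_ge0 ?expR_ge0 // exprn_ge0 // ltW.
rewrite thE -!expRD ler_expR; have : 0 <= n%:R :> R by [].
by move: (n%:R : R) ca => x ca x0; nra.
Qed.

Context (G : mgraph) (Gam : set (gaut G)) {act : transitive_action Gam}.
Context (w : gpath G -> R) {wgood : good_weight Gam w}.
Hypothesis nonuni : ~ unimodular R Gam.

Let Glf : locally_finite G := action_locally_finite.

Local Notation height := (@height R G Gam).
Local Notation pweight := (pweight Gam w).
Local Notation PSum v A z l := (\esum_(p in from v A) (pweight z l p)%:E)%E.
Local Notation Z o l n := (Zw Gam o w l n).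
Implicit Types (p q r : gpath G).

(** If [x] lies above [o], the tilt 1/2 only increases the weights; otherwise
the same holds for the reversed paths. *)
Lemma two_point_le_chi o x z (M : R) : 0 <= z ->
  (PSum o setT z 2^-1 <= M%:E)%E -> (two_point o w z x <= M%:E)%E.
Proof.
move=> z0 hM; have W0 p : (0 <= (pweight z 2^-1 p)%:E)%E by rewrite lee_fin pweight_ge0.
have wz0 p : 0 <= w p * z ^+ plen p.
  by rewrite mulr_ge0 ?exprn_ge0 //; apply: (weight_ge0 wgood).
apply: le_trans hM; rewrite /two_point; have [hx|hx] := leP 0 (height o x).
  apply: (le_esum_inj (e := id)) => // [p []//|p [sp ep]].
  rewrite lee_fin /pweight sp ep ler_peMr // expR_ge1 mulr_ge0 //.
rewrite (psum_transport o x) //.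
apply: (le_esum_inj (e := @Defs.prev G)) => // [p [sp ep]||p [sp ep]].
- by split; rewrite // pstart_prev.
- by move=> p q _ _ /(inv_inj (@prevK G)).
- rewrite lee_fin pweight_prev sp ep ler_peMr // expR_ge1.
  by rewrite mulNr -mulrN mulr_ge0 // oppr_ge0 ltW.
Qed.

(** Paths to [x] have length at least the distance, so comparing [z] with some
[y] strictly between [z] and z_t gains a factor smaller than 1 per unit of
distance. *)
Lemma two_point_decay o z : 0 <= z -> z < z_t Gam o w ->
  exists c C : R, 0 < c /\ 0 < C /\
    forall x, (two_point o w z x <= (C * expR (- c * (gdist o x)%:R))%:E)%E.
Proof.
move=> z0 zt; pose y := (z + z_t Gam o w) / 2.
have [{}y zy yt] : exists2 y, z < y & y < z_t Gam o w.
  by exists y; rewrite /y; [rewrite ltr_pdivlMr // | rewrite ltr_pdivrMr //];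
    rewrite mulr_natr mulr2n; [rewrite ltrD2l | rewrite ltrD2r].
have y0 : 0 < y by apply: le_lt_trans zy.
have [M hM] := chi_subcritical nonuni (ltW y0) yt.
rewrite chi_psum in hM; last exact: ltW.
pose q := (1 + z / y) / 2.
have [{}q q0 [q1 zq]] : exists2 q, 0 < q & q < 1 /\ z <= q * y.
  have h0 : 0 <= z / y by rewrite divr_ge0 // ltW.
  have h1 : z / y < 1 by rewrite ltr_pdivrMr // mul1r.
  exists q; rewrite /q; first by lra.
  split; first by lra.
  by rewrite -ler_pdivrMr //; lra.
exists (- ln q), (`|M| + 1); split; first by rewrite oppr_gt0 ln_lt0 // q0.
split; first by rewrite ltr_wpDl.
move=> x; have qE n : expR (- - ln q * n%:R) = q ^+ n.
  by rewrite opprK mulrC expRM_natl lnK // posrE.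
rewrite qE; apply: (@le_trans _ _ ((q ^+ gdist o x)%:E * two_point o w y x)%E).
  rewrite /two_point -esumZl ?exprn_ge0 ?(ltW q0) //; last first.
    move=> p _; rewrite lee_fin mulr_ge0 ?exprn_ge0 ?(ltW y0) //.
    exact: (weight_ge0 wgood).
  apply: le_esum => p [sp ep]; rewrite -EFinM lee_fin mulrCA ler_wpM2l //.
    exact: (weight_ge0 wgood).
  apply: (@le_trans _ _ ((q * y) ^+ plen p)).
    by rewrite lerXn2r ?nnegrE // mulr_ge0 ?(ltW q0) ?(ltW y0).
  rewrite exprMn ler_wpM2r ?exprn_ge0 ?(ltW y0) // ler_wiXn2l ?(ltW q0) ?(ltW q1) //.
  by rewrite -sp -ep; apply: gdist_le.
rewrite mulrC EFinM; apply: lee_wpmul2l; first by rewrite lee_fin exprn_ge0 // ltW.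
apply: le_trans (two_point_le_chi x (ltW y0) hM) _.
by rewrite lee_fin ler_wpDr // ler_norm.
Qed.

Section PathMeasure.
Variables (o : G) (l : R).

Let W0 p : (0 <= (pweight 1 l p)%:E)%E. Proof. by rewrite lee_fin pweight_ge0. Qed.

Lemma path_prob_psum n (A : set (gpath G)) :
  ((path_prob Gam o w l n A)%:E =
   ((Z o l n)^-1)%:E * PSum o (len_eq n `&` A) 1 l)%E.
Proof.
have fin : finite_set (paths_from o n `&` A).
  by apply: sub_finite_set (finite_paths_len Glf o n) => p [].
have -> : from o (len_eq n `&` A) = paths_from o n `&` A.
  by apply/seteqP; split=> p; [move=> [? []]|move=> [[]]].
have i0 : 0 <= (Z o l n)^-1 by rewrite invr_ge0 Zw_ge0.
rewrite -esumZl // esum_fset //; last first.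
  by move=> p _; rewrite mule_ge0.
rewrite /path_prob !fsbig_finite //= sumEFin; congr EFin.
rewrite big_seq [RHS]big_seq; apply: eq_bigr => p.
rewrite in_fset_set // inE => -[[sp _] _].
by rewrite /pweight expr1n mulr1 modular_powR sp.
Qed.

Lemma path_prob_mono n (A B : set (gpath G)) :
  (forall p, pstart p = o -> A p -> B p) ->
  path_prob Gam o w l n A <= path_prob Gam o w l n B.
Proof.
move=> AB; rewrite -lee_fin !path_prob_psum lee_wpmul2l //.
  by rewrite lee_fin invr_ge0 Zw_ge0.
apply: le_esum_subset => // p [sp [pn Ap]]; split=> //; split=> //; exact: AB.
Qed.

Lemma path_prob_ge_path n (A : set (gpath G)) p :
  pstart p = o -> plen p = n -> A p ->
  (Z o l n)^-1 * pweight 1 l p <= path_prob Gam o w l n A.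
Proof.
move=> sp lp Ap; rewrite -lee_fin path_prob_psum EFinM lee_wpmul2l //.
  by rewrite lee_fin invr_ge0 Zw_ge0.
rewrite -(@esum_set1 R _ p (fun q => (pweight 1 l q)%:E)) //.
by apply: le_esum_subset => // q ->.
Qed.

Lemma path_prob_ge_compl n (A : set (gpath G)) x :
  (PSum o (len_eq n `&` ~` A) 1 l <= x%:E)%E ->
  1 - (Z o l n)^-1 * x <= path_prob Gam o w l n A.
Proof.
move=> hx; have Z0 : 0 < Z o l n by exact: Zw_gt0.
have i0 : 0 < (Z o l n)^-1 by rewrite invr_gt0.
have ZE : (PSum o (len_eq n) 1 l = (Z o l n)%:E).
  by rewrite psum_len_eq // expr1n mul1r.
have cE (B : set (gpath G)) : from o (len_eq n) `&` B = from o (len_eq n `&` B).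
  by apply/seteqP; split=> p; [move=> [[]]|move=> [? []]].
rewrite (esumID A) // !cE in ZE.
have : ((Z o l n)^-1%:E * (Z o l n)%:E <=
    (path_prob Gam o w l n A)%:E + ((Z o l n)^-1 * x)%:E)%E.
  rewrite -ZE ge0_muleDr ?esum_ge0 // -path_prob_psum leeD2l // EFinM.
  by apply: lee_wpmul2l => //; rewrite lee_fin ltW.
by rewrite -EFinM mulVf ?gt_eqF // -EFinD lee_fin lerBlDr.
Qed.

(** The Chernoff bound: off the event, the tilt [l] exceeds the tilt 1/2 by a
factor that is at most exponential in [c]. *)
Lemma psum_low_height_le n (c : R) :
  (PSum o (len_eq n `&` ~` [set p | (c <= Num.sg (l - 2^-1) * height o (pend p))%R]) 1 l <=
   (expR (`|l - 2^-1| * c) * Z o 2^-1 n)%:E)%E.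
Proof.
have e : (PSum o (len_eq n) 1 2^-1 = (Z o 2^-1 n)%:E).
  by rewrite psum_len_eq // expr1n mul1r.
have W0' p : (0 <= (pweight 1 2^-1 p)%:E)%E by rewrite lee_fin pweight_ge0.
rewrite EFinM -e -esumZl ?expR_ge0 //.
apply: (le_esum_inj (e := id)) => // [p [sp [pn _]]//|p [sp [pn /negP]]|p _]; last first.
  by rewrite mule_ge0 // lee_fin expR_ge0.
rewrite -ltNge => hp; rewrite -EFinM lee_fin /pweight sp mulrCA ler_wpM2l //.
  by rewrite mulr_ge0 ?exprn_ge0 //; apply: (weight_ge0 wgood).
rewrite -expRD ler_expR -lerBlDr -mulrBl {1}[l - 2^-1]numEsg mulrAC mulrC.
by rewrite ler_wpM2l // ltW.
Qed.

Lemma path_prob_chernoff n (c : R) : 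
  1 - (Z o l n)^-1 * (expR (`|l - 2^-1| * c) * Z o 2^-1 n) <=
  path_prob Gam o w l n [set p | c <= Num.sg (l - 2^-1) * ln (modular R Gam o (pend p))].
Proof. by apply: path_prob_ge_compl; apply: psum_low_height_le. Qed.

(** A monotone path in the favoured direction has positive probability. *)
Lemma path_prob_climb : l <> 2^-1 -> exists2 d : R, 0 < d & exists2 del : nat -> R,
  (forall n, 0 < del n) & forall n (c : R), c <= n%:R * d ->
    del n <= path_prob Gam o w l n
      [set p | c <= Num.sg (l - 2^-1) * ln (modular R Gam o (pend p))].
Proof.
move=> /eqP l2; have [d d0 hd] := climbing_edge nonuni; exists d => //.
pose s := Num.sg (l - 2^-1).
have s1 : s ^+ 2 = 1 by rewrite /s sqr_sg subr_eq0 l2.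
have Zp n : 0 < Z o l n by exact: Zw_gt0.
exists (fun n => (Z o l n)^-1 * expR (l * (s * (n%:R * d)))).
  by move=> n; rewrite mulr_gt0 ?expR_gt0 // invr_gt0.
move=> n c cn; have [p [sp lp rp wp]] : exists p, [/\ pstart p = o, plen p = n,
    (forall i, (i <= n)%N -> s * height o (pvertex p i) = i%:R * d) & 1 <= w p].
  by apply: monotone_path => //; exact: hd.
have he : s * height o (pend p) = n%:R * d by rewrite -pvertex_plen lp rp.
apply: le_trans (path_prob_ge_path sp lp _); last by rewrite /= -/(height _ _) he.
rewrite ler_wpM2l ?invr_ge0 ?(ltW (Zp n)) // /pweight expr1n mulr1 sp.
rewrite -he mulrA -expr2 s1 mul1r ler_peMl ?expR_ge0 //.
Qed.

End PathMeasure.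

Lemma ballistic_height o l : l <> 2^-1 -> exists2 c : R, 0 < c &
  forall n, 1 - expR (- c * n%:R) <= path_prob Gam o w l n
    [set p | c * n%:R <= Num.sg (l - 2^-1) * ln (modular R Gam o (pend p))].
Proof.
move=> l2; have ms : mu_c Gam o w 2^-1 < mu_c Gam o w l by exact: mu_c_strict.
have ml : 0 < mu_c Gam o w l by exact: mu_c_gt0.
have m2 : 0 < mu_c Gam o w 2^-1 by exact: mu_c_gt0.
have lo n : mu_c Gam o w l ^+ n <= Z o l n by exact: mu_c_le.
have geo rho : mu_c Gam o w 2^-1 < rho -> 
  exists2 C, 0 < C & forall n, Z o 2^-1 n <= C * rho ^+ n by exact: Zw_le_geometric.
move: (mu_c Gam o w l) (mu_c Gam o w 2^-1) ms ml m2 lo geo => m m' ms ml m2 lo geo.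
pose rho := (m + m') / 2.
have [{}rho rho1 rho2] : exists2 rho, m' < rho & rho < m.
  by exists rho; rewrite /rho; lra.
have [C C0 hC] := geo rho rho1.
have [d d0 [del del0 hdel]] : exists2 d : R, 0 < d & exists2 del : nat -> R,
    (forall n, 0 < del n) & forall n (c : R), c <= n%:R * d ->
    del n <= path_prob Gam o w l n
      [set p | c <= Num.sg (l - 2^-1) * ln (modular R Gam o (pend p))].
  exact: path_prob_climb.
have r0 : 0 < rho by apply: lt_trans rho1.
have th0 : 0 < rho / m by rewrite divr_gt0.
have th1 : rho / m < 1 by rewrite ltr_pdivrMr // mul1r.
have [c c0 [cd hc]] := exists_rate C th0 th1 d0 (normr_ge0 (l - 2^-1)) del0.
exists c => // n; have [h|h] := hc n.
  by apply: le_trans h _; apply: hdel; rewrite mulrC ler_wpM2l.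
apply: le_trans (path_prob_chernoff _ _ _ _); rewrite lerD2l lerN2.
apply: le_trans h; have Zp : 0 < Z o l n by exact: Zw_gt0.
rewrite mulrCA [C * _]mulrCA ler_wpM2l ?expR_ge0 //.
rewrite ler_pdivrMl //; apply: le_trans (hC n) _.
rewrite expr_div_n mulrCA ler_wpM2l ?(ltW C0) //.
rewrite mulrCA ler_peMr ?exprn_ge0 ?(ltW r0) //.
by rewrite ler_pdivlMr ?exprn_gt0 // mul1r.
Qed.

(** Heights change by at most a constant along an edge. *)
Lemma ballistic_distance o l (c : R) : 0 < c ->
  (forall n, 1 - expR (- c * n%:R) <= path_prob Gam o w l n
    [set p | c * n%:R <= Num.sg (l - 2^-1) * ln (modular R Gam o (pend p))]) ->
  exists2 c' : R, 0 < c' &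
  forall n, 1 - expR (- c' * n%:R) <= path_prob Gam o w l n
    [set p | c' * n%:R <= (gdist o (pend p))%:R].
Proof.
move=> c0 hc; have [L L0 hL] := @edge_height_bounded R G Gam act.
pose c' := Num.min c (c / L).
have c'0 : 0 < c' by rewrite /c' lt_min c0 divr_gt0.
have cc : c' <= c by rewrite /c' ge_min lexx.
have cL : c' * L <= c by rewrite -ler_pdivlMr // /c' ge_min lexx orbT.
clearbody c'; exists c' => // n; apply: (@le_trans _ _ (1 - expR (- c * n%:R))).
  by rewrite lerD2l lerN2 ler_expR ler_wpM2r // lerN2.
apply: le_trans (hc n) _; apply: path_prob_mono => p sp /= hp.
have hd : Num.sg (l - 2^-1) * height o (pend p) <= L * (gdist o (pend p))%:R.
  apply: le_trans (height_le_gdist o (pend p) hL).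
  apply: le_trans (ler_norm _) _; rewrite normrM normr_sg ler_piMl //.
  by case: (_ != 0).
rewrite -(ler_pM2l L0); apply: le_trans hd; apply: le_trans hp.
by rewrite mulrA [L * _]mulrC ler_wpM2r.
Qed.

End Conclusions.

Theorem theorem1p9 (R : realType) (G : mgraph)
  (Gconn : connected_graph G) (Glf : locally_finite G)
  (Gam : set (gaut G)) (Gam_sub : aut_subgroup Gam)
  (Gam_trans : transitive_aut Gam) (Gam_nonuni : ~ unimodular R Gam)
  (o : G) (w : gpath G -> R) (w_good : good_weight Gam w) :
  [/\ (forall lam : R, lam <> 2^-1 ->
        exists C : R, 0 < C /\
          (forall z : R, 0 < z -> z < z_c Gam o w lam ->
            ((z_c Gam o w lam / (z_c Gam o w lam - z))%:E
               <= chi Gam o w z lam)%E /\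
            (chi Gam o w z lam
               <= (C * z_c Gam o w lam / (z_c Gam o w lam - z))%:E)%E) /\
          (forall n : nat,
            mu_c Gam o w lam ^+ n <= Zw Gam o w lam n /\
            Zw Gam o w lam n <= C * mu_c Gam o w lam ^+ n)),
      (forall z : R, 0 <= z -> z < z_t Gam o w ->
        exists c C : R, 0 < c /\ 0 < C /\
          forall x : G,
            (two_point o w z x <= (C * expR (- c * (gdist o x)%:R))%:E)%E) &
      (forall lam : R, lam <> 2^-1 ->
        exists c c' : R, 0 < c /\ 0 < c' /\
          (forall n : nat,
            1 - expR (- c * n%:R) <=
            path_prob Gam o w lam n
              [set X | c * n%:R <=
                 Num.sg (lam - 2^-1) * ln (modular R Gam o (pend X))]) /\
          (forall n : nat,
            1 - expR (- c' * n%:R) <=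
            path_prob Gam o w lam n
              [set X | c' * n%:R <= (gdist o (pend X))%:R]))].
Proof.
have act : transitive_action Gam by split.
split=> [lam lam2|z|lam lam2].
- have [C C0 hC] : exists2 C : R, 0 < C &
      forall n, Zw Gam o w lam n <= C * mu_c Gam o w lam ^+ n by exact: Zw_le_mu.
  have lo n : mu_c Gam o w lam ^+ n <= Zw Gam o w lam n by exact: mu_c_le.
  have m0 : 0 < mu_c Gam o w lam by exact: mu_c_gt0.
  exists C; split=> //; split=> [z z0 zc|n]; last by split; [exact: lo | exact: hC].
  exact: (eseries_between m0 C0 lo hC z0 zc).
- exact: (two_point_decay Gam_nonuni).
- have [c c0 hc] : exists2 c : R, 0 < c &
      forall n, 1 - expR (- c * n%:R) <= path_prob Gam o w lam n
        [set p | c * n%:R <= Num.sg (lam - 2^-1) * ln (modular R Gam o (pend p))].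
    exact: ballistic_height.
  have [c' c'0 hc'] := ballistic_distance c0 hc.
  by exists c, c'.
Qed.
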